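(* Let $\Theta$ be a compact subset of $\mathbb{R}^d$. Assume that $\sup_{\theta\in\Theta}H_2^\theta(\alpha)<\infty$ for all $\alpha\in\mathbb{R}^m$, where $H_2^\theta(\alpha)=\log\mathbb{E}\,e^{\langle\alpha,G(X_1,\theta)\rangle}$. If $\varphi:\mathbb{R}^m\to\mathbb{R}$ is continuous and bounded, then $g^n\to g$ uniformly on $\Theta$ as $n\to\infty$, where for $\theta\in\Theta$ $$g^n(\theta)=-\frac1n\log\mathbb{E}\left[\exp\left\{-n\varphi\left(\frac1n\sum_{i=1}^nG(X_i,\theta)\right)\right\}\right]$$ and $$g(\theta)=\inf_{\nu\in\mathscr{P}(\mathbb{R}^h)}\left[\varphi\left(\int_{\mathbb{R}^h}G(x,\theta)\,\nu(dx)\right)+R(\nu\|\eta)\right].$$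
   Context: $X_1,X_2,\dots$ are i.i.d. random variables in $\mathbb{R}^h$ with distribution $\eta$, and $G:\mathbb{R}^h\times\Theta\to\mathbb{R}^m$ is continuous. $\mathscr{P}(\mathbb{R}^h)$ is the space of probability measures on $\mathbb{R}^h$. $R(\nu\|\eta)$ is the relative entropy: $R(\nu\|\eta)=\int_{\mathbb{R}^h}\log\frac{d\nu}{d\eta}\,d\nu$ if $\nu$ is absolutely continuous with respect to $\eta$, and $\infty$ otherwise. In the definition of $g$, the bracket is understood to equal $+\infty$ when $R(\nu\|\eta)=\infty$. *)

(* Defs.v *)
From HB Require Import structures.
From mathcomp Require Import all_boot all_order all_algebra finmap.
From mathcomp Require Import all_classical all_reals all_analysis.
Import Order.TTheory GRing.Theory Num.Theory.
Import numFieldNormedType.Exports.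

Set Implicit Arguments.
Unset Strict Implicit.
Unset Printing Implicit Defensive.

Local Open Scope classical_set_scope.
Local Open Scope ring_scope.

(* R^n with its Borel sigma-algebra. The carrier is convertible to 'rV[R]_n. *)
Notation borel_rV R n := (g_sigma_algebraType (@open 'rV[R]_n)).

Definition inner (R : realType) (n : nat) (u v : 'rV[R]_n) : R :=
  \sum_(i < n) u 0 i * v 0 i.

Definition mutually_independent (R : realType) (d d' : measure_display)
    (Omega : measurableType d) (T : measurableType d') (P : probability Omega R)
    (I : choiceType) (X : I -> {RV P >-> T}) : Prop :=
  forall (J : {fset I}) (A : I -> set T),
    (forall i, i \in J -> measurable (A i)) ->
    P (\bigcap_(i in [set` J]) (X i @^-1` A i)) =
    (\prod_(i <- J) P (X i @^-1` A i))%E.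

Definition has_distribution (R : realType) (d d' : measure_display)
    (Omega : measurableType d) (T : measurableType d') (P : probability Omega R)
    (X : {RV P >-> T}) (eta : probability T R) : Prop :=
  forall A : set T, measurable A -> distribution P X A = eta A.

Definition iid (R : realType) (d d' : measure_display)
    (Omega : measurableType d) (T : measurableType d') (P : probability Omega R)
    (X : nat -> {RV P >-> T}) (eta : probability T R) : Prop :=
  mutually_independent X /\ forall i, has_distribution (X i) eta.

(* The library's density is only determined up to an eta-null set, and lne
   sends [-oo, 0] to -oo; both are immaterial under nu when nu `<< eta. The
   negative part of the integrand is always nu-integrable, so the integral is a
   genuine element of [0, +oo]. *)
Definition relative_entropy (R : realType) (d : measure_display)
    (T : measurableType d) (nu eta : probability T R) : \bar R :=
  if `[< nu `<< eta >] then
    (\int[nu]_x lne (Radon_Nikodym (charge_of_finite_measure nu) eta x))%E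
  else +oo%E.

(* Coordinatewise integral; a coordinate that is not nu-integrable gets a
   conventional real value. *)
Definition vec_integral (R : realType) (d : measure_display)
    (T : measurableType d) (m : nat) (nu : probability T R)
    (f : T -> 'rV[R]_m) : 'rV[R]_m :=
  \row_(j < m) \int[nu]_(x in setT) f x 0 j.

Definition H2 (R : realType) (d d' : measure_display)
    (Omega : measurableType d) (T : measurableType d') (P : probability Omega R)
    (k m : nat) (X1 : {RV P >-> T}) (G : T -> 'rV[R]_k -> 'rV[R]_m)
    (theta : 'rV[R]_k) (alpha : 'rV[R]_m) : \bar R :=
  lne ('E_P[fun w => expR (inner alpha (G (X1 w) theta))])%E.

(* Indices start at 0: X_1, X_2, ... are X 0, X 1, ..., so X_1, ..., X_n are
   the X i with i < n. *)
Definition gn (R : realType) (d d' : measure_display)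
    (Omega : measurableType d) (T : measurableType d') (P : probability Omega R)
    (k m : nat) (X : nat -> {RV P >-> T}) (G : T -> 'rV[R]_k -> 'rV[R]_m)
    (phi : 'rV[R]_m -> R) (n : nat) (theta : 'rV[R]_k) : R :=
  - (n%:R^-1 * ln (fine ('E_P[fun w =>
      expR (- (n%:R * phi (n%:R^-1 *: \sum_(i < n) G (X i w) theta)))])%E)).

(* phi takes real values, so the bracket is +oo whenever the relative entropy
   is, whatever the conventional value of the integral. *)
Definition g (R : realType) (d : measure_display) (T : measurableType d)
    (k m : nat) (eta : probability T R) (G : T -> 'rV[R]_k -> 'rV[R]_m)
    (phi : 'rV[R]_m -> R) (theta : 'rV[R]_k) : \bar R :=
  ereal_inf (range (fun nu : probability T R =>
    ((phi (vec_integral nu (G^~ theta)))%:E + relative_entropy nu eta)%E)).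

(* Main.v *)
Require Import Defs.
From HB Require Import structures.
From mathcomp Require Import all_boot all_order all_algebra finmap.
From mathcomp Require Import all_classical all_reals all_analysis.
From mathcomp Require Import measurable_realfun ring lra.
Import Order.TTheory GRing.Theory Num.Theory.
Import numFieldNormedType.Exports.

(** Write [M t a] for the expectation of [expR (inner a (G x t))] under [eta] and
    [Lam t a] for its logarithm. Independence enters only through the identity
    [E (expR (n * inner a S_n)) = expR (n * Lam t a)] for the empirical mean [S_n]
    of the [G (X_i) t], so the proof works with moment generating functions
    throughout.

    Duality. The infimum defining [g] may be taken over the exponential tilts
    [nu_a] of [eta], whose densities are [expR (inner a (G x t) - Lam t a)]. The
    mean of [nu_a] is the gradient [mean a] of [Lam t] at [a], and its relative
    entropy is [inner a (mean a) - Lam t a] ([exponential_tilt]). Any [nu] of finite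
    entropy with mean [b] satisfies [inner a b - Lam t a <= R(nu | eta)]
    ([relative_entropy_ge]). Minimising
    [Lam t a - inner a b + delta / 2 * inner a a] over [a] produces a tilt whose
    mean is [b - delta *: a] and whose entropy is at most [inner a b - Lam t a]
    ([regularized_minimiser], [tilt_near]): up to a small displacement of the mean,
    a tilt is at least as good as [nu]. Two facts follow at each [t]:
    for every [b] some [a] has [g t - e <= phi b + inner a b - Lam t a]
    ([entropic_inf_le_conjugate]), and some tilt is [e]-optimal
    ([tilt_le_entropic_inf]).

    Lower bound for [gn]. By the first fact, compactness of a box, and the linear
    growth of coordinate functionals outside it, finitely many [a] suffice for all
    [b] simultaneously ([finite_conjugate_cover]). Hence [expR (- n * phi y)] is
    pointwise at most a finite sum of functions
    [expR (n * (inner a y - Lam t a - g t + e))], whose expectations at [y = S_n]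
    are explicit ([free_energy_ge]).

    Upper bound for [gn]. For the [e]-optimal tilt [a] with mean [b], the law of
    large numbers under the tilted law is replaced by Chernoff's inequality, which
    again only involves [Lam t] at [a] and at the points [a +- s e_j]
    ([free_energy_le]).

    Uniformity. Both bounds use the values of [Lam] at finitely many [a], and
    [Lam t a] is continuous in [t] ([near_log_mgf_family], where the uniform
    exponential moments give uniform integrability). So [gn n t] is within [e] of
    [g t0] for [t] near [t0] and [n] large ([near_gn]). This continuous convergence
    gives continuity of [g] and then, [Theta] being compact, uniform convergence. *)

Set Implicit Arguments.
Unset Strict Implicit.
Unset Printing Implicit Defensive.

Local Open Scope classical_set_scope.
Local Open Scope ring_scope.

(** * Transfer of integrals from indicators to nonnegative functions *)

Lemma measurable_EFin (R : realType) (d : measure_display)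
    (T : measurableType d) (D : set T) (f : T -> R) :
  measurable_fun D f -> measurable_fun D (fun x => (f x)%:E).
Proof. by move=> mf; exact/measurable_EFinP. Qed.

Section integral_transfer.
Import HBNNSimple.
Local Open Scope ereal_scope.

Lemma integral_transfer_nnsfun (R : realType) (d d' : measure_display)
    (Omega : measurableType d) (T : measurableType d')
    (P : {measure set Omega -> \bar R}) (nu : {measure set T -> \bar R})
    (X : Omega -> T) (W : Omega -> R) (c : R) (h : {nnsfun T >-> R}) :
  measurable_fun [set: Omega] X -> measurable_fun [set: Omega] W ->
  (forall w, 0 <= W w)%R -> (0 <= c)%R ->
  (forall A, measurable A ->
     \int[P]_w (\1_A (X w) * W w)%:E = c%:E * nu A) ->
  \int[P]_w (h (X w) * W w)%:E = c%:E * \int[nu]_x (h x)%:E.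
Proof.
move=> mX mW W0 c0 XW.
have mpre r : measurable (h @^-1` [set r]) by [].
have hr0 r : range h r -> (0 <= r)%R by case=> x _ <-.
under [in RHS]eq_integral do rewrite fimfunE -fsumEFin//.
rewrite ge0_integral_fsum//; [|by move=> r; apply: measurable_EFin;
  exact: measurable_funM|by move=> r x _; exact: nnfun_muleindic_ge0].
rewrite ge0_mule_fsumr; last first.
  move=> r; apply: integral_ge0 => x _; exact: nnfun_muleindic_ge0.
transitivity (\int[P]_w \sum_(r \in range h)
    (r * (\1_(h @^-1` [set r]) (X w) * W w))%:E).
  apply: eq_integral => w _.
  rewrite {1}fimfunE EFinM -fsumEFin// ge0_mule_fsuml; last first.
    by move=> r; exact: nnfun_muleindic_ge0.
  by apply: eq_fsbigr => r _; rewrite -EFinM mulrA.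
rewrite ge0_integral_fsum//; last 2 first.
- move=> r; apply: measurable_EFin; apply: measurable_funM => //.
  apply: measurable_funM => //.
  exact: (measurableT_comp (measurable_indic (mpre r)) mX).
- move=> r w _; rewrite mulrA EFinM mule_ge0 ?lee_fin//.
  by have := nnfun_muleindic_ge0 h r (X w); rewrite lee_fin.
apply: eq_fsbigr => r /[!inE] hr.
under eq_integral do rewrite EFinM.
rewrite ge0_integralZl//; last 3 first.
- apply: measurable_EFin; apply: measurable_funM => //.
  exact: (measurableT_comp (measurable_indic (mpre r)) mX).
- by move=> w _; rewrite lee_fin mulr_ge0.
- by rewrite lee_fin hr0.
under [in RHS]eq_integral do rewrite EFinM.
rewrite ge0_integralZl//; last 2 first.
- exact: measurable_EFin.
- by rewrite lee_fin hr0.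
by rewrite XW// integral_indic// setIT muleCA.
Qed.

(** One statement covers image laws ([W = 1]), changes of density ([X = id]) and
    the replacement of one factor of a product of independent variables ([W] is
    the product of the others, [c] its expectation). *)
Lemma integral_transfer (R : realType) (d d' : measure_display)
    (Omega : measurableType d) (T : measurableType d')
    (P : {measure set Omega -> \bar R}) (nu : {measure set T -> \bar R})
    (X : Omega -> T) (W : Omega -> R) (c : R) (h : T -> \bar R) :
  measurable_fun [set: Omega] X -> measurable_fun [set: Omega] W ->
  (forall w, 0 <= W w)%R -> (0 <= c)%R ->
  (forall A, measurable A ->
     \int[P]_w (\1_A (X w) * W w)%:E = c%:E * nu A) ->
  measurable_fun [set: T] h -> (forall x, 0 <= h x) ->
  \int[P]_w (h (X w) * (W w)%:E) = c%:E * \int[nu]_x h x.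
Proof.
move=> mX mW W0 c0 XW mh h0.
pose f := nnsfun_approx measurableT mh.
have cf x : EFin (f n x) @[n --> \oo] --> h x.
  exact: (cvg_nnsfun_approx measurableT mh (fun x _ => h0 x)).
have ndf x m n : (m <= n)%N -> (f m x <= f n x)%R.
  by move=> mn; exact/lefP/nd_nnsfun_approx.
have L : \int[P]_w (f n (X w) * W w)%:E @[n --> \oo] -->
    \int[P]_w (h (X w) * (W w)%:E).
  have -> : \int[P]_w (h (X w) * (W w)%:E) =
      \int[P]_w limn (fun n => (f n (X w) * W w)%:E).
    apply: eq_integral => w _; apply/esym/cvg_lim => //.
    under eq_fun do rewrite EFinM.
    by apply: cvgeZr => //; exact: cf.
  apply: cvg_monotone_convergence => //.
  - move=> n; apply: measurable_EFin; apply: measurable_funM => //.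
    exact: measurableT_comp.
  - by move=> n w _; rewrite lee_fin mulr_ge0.
  - by move=> w _ m n mn; rewrite lee_fin ler_wpM2r// ndf.
have Rr : c%:E * \int[nu]_x (f n x)%:E @[n --> \oo] --> c%:E * \int[nu]_x h x.
  apply: cvgeZl => //.
  have -> : \int[nu]_x h x = \int[nu]_x limn (fun n => (f n x)%:E).
    by apply: eq_integral => w _; apply/esym/cvg_lim => //; exact: cf.
  apply: cvg_monotone_convergence => //.
  - by move=> n; apply: measurable_EFin.
  - by move=> n w _; rewrite lee_fin.
  - by move=> w _ m n mn; rewrite lee_fin ndf.
have E : (fun n => \int[P]_w (f n (X w) * W w)%:E) =
    (fun n => c%:E * \int[nu]_x (f n x)%:E).
  by apply/funext => n; apply: integral_transfer_nnsfun.
by rewrite E in L; exact: cvg_unique L Rr.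
Qed.

End integral_transfer.

(** * Measurability and products over an i.i.d. sample *)

(** An open set is a countable union of boxes with rational centres. *)
Lemma measurable_preimage_open_rV (R : realType) (d : measure_display)
    (Omega : measurableType d) (m : nat) (Y : Omega -> 'rV[R]_m)
    (U : set 'rV[R]_m) :
  (forall j, measurable_fun [set: Omega] (fun w => Y w 0 j)) -> open U ->
  measurable (Y @^-1` U).
Proof.
move=> mY oU.
pose box (b : 'rV[rat]_m * nat) : set 'rV[R]_m :=
  [set y | forall j, `|y 0 j - ratr (b.1 0 j)| < b.2.+1%:R^-1].
have mbox b : measurable (Y @^-1` box b).
  have -> : Y @^-1` box b = \bigcap_(j in [set: 'I_m])
      ((fun w => `|Y w 0 j - ratr (b.1 0 j)|) @^-1` `]-oo, b.2.+1%:R^-1[).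
    apply/seteqP; split=> w /=.
      by move=> H j _ /=; rewrite in_itv/=; exact: H.
    by move=> H j; have := H j I; rewrite /= in_itv.
  apply: fin_bigcap_measurable => // j _.
  rewrite -[X in measurable X]setTI.
  have mf : measurable_fun [set: Omega] (fun w => `|Y w 0 j - ratr (b.1 0 j)|).
    by apply: measurableT_comp => //; exact: measurable_funB.
  exact: mf.
have -> : Y @^-1` U = \bigcup_(b in [set: 'rV[rat]_m * nat])
    (if pselect (box b `<=` U) then Y @^-1` box b else set0).
  apply/seteqP; split=> w /=; last first.
    by move=> [b _]; case: pselect => //= bU; exact: bU.
  move=> UYw.
  have /nbhs_ballP [e /= e0 eU] : nbhs (Y w) U by exact: open_nbhs_nbhs.
  have e20 : 0 < e / 2 by rewrite divr_gt0.
  have [k] := ltr_add_invr e20; rewrite add0r => ke.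
  have k0 : 0 < (k.+1%:R^-1 : R) by rewrite invr_gt0.
  have /choice [q qE] (j : 'I_m) : exists q : rat,
      `|Y w 0 j - ratr q| < k.+1%:R^-1.
    have [|q] := @rat_in_itvoo R (Y w 0 j - k.+1%:R^-1) (Y w 0 j + k.+1%:R^-1).
      by move: k0; set x := k.+1%:R^-1; lra.
    rewrite in_itv/= => /andP[q1 q2]; exists q.
    rewrite ltr_norml; move: q1 q2; set x := k.+1%:R^-1 => q1 q2.
    by apply/andP; split; lra.
  exists (\row_j q j, k) => //.
  case: pselect => /= [bU j|nbU]; first by rewrite mxE; exact: qE.
  exfalso; apply: nbU => y by_; apply: eU; split => // i j.
  rewrite ord1 /ball /=.
  have := by_ j; have := qE j; move: ke.
  rewrite /= mxE; set x := k.+1%:R^-1 => ke h1 h2.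
  have -> : Y w 0 j - y 0 j = (Y w 0 j - ratr (q j)) - (y 0 j - ratr (q j)).
    by ring.
  apply: (le_lt_trans (ler_normB _ _)); lra.
apply: countable_bigcupT_measurable => [|b]; first exact: countableP.
by case: pselect => /= _; [exact: mbox|exact: measurable0].
Qed.

Lemma measurable_continuous_rV (R : realType) (d : measure_display)
    (Omega : measurableType d) (m : nat) (Y : Omega -> 'rV[R]_m)
    (f : 'rV[R]_m -> R) :
  (forall j, measurable_fun [set: Omega] (fun w => Y w 0 j)) -> continuous f ->
  measurable_fun [set: Omega] (fun w => f (Y w)).
Proof.
move=> mY /continuousP cf.
apply: (measurability _ (RGenOpens.measurableE R)).
move=> _ [_ [a [b ->] <-]]; rewrite setTI.
have -> : (fun w => f (Y w)) @^-1` `]a, b[ = Y @^-1` (f @^-1` `]a, b[) by [].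
apply: measurable_preimage_open_rV => //.
by apply: cf; exact: interval_open.
Qed.

Lemma prod_indic_bigcap (R : realType) (Omega T : Type) (n : nat)
    (X : nat -> Omega -> T) (A : nat -> set T) (w : Omega) :
  \prod_(i < n) (\1_(A i) (X i w) : R) =
  \1_(\bigcap_(i in [set k | (k < n)%N]) (X i @^-1` A i)) w.
Proof.
rewrite [RHS]indicE; have [|] := boolP (w \in _).
  rewrite inE => h; rewrite big1// => i _.
  by rewrite indicE mem_set//; exact: (h i (ltn_ord i)).
move=> /negP h.
have [i Ai] : exists i : 'I_n, ~ A i (X i w).
  apply: contrapT => /forallNP H; apply: h; rewrite inE => i /= ilt.
  by have /contrapT := H (Ordinal ilt).
by rewrite (bigD1 i)//= indicE memNset// mul0r.
Qed.

Section product_expectation.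
Local Open Scope ereal_scope.

(** Independence is a statement on events, that is the case [k = 0]. The
    indicators are then traded for [h] one factor at a time: for fixed other
    factors, [integral_transfer] extends the identity from indicators of the
    [k]-th variable to [h]. *)
Lemma expectation_prod_partial (R : realType) (d d' : measure_display)
    (Omega : measurableType d) (T : measurableType d') (P : probability Omega R)
    (X : nat -> {RV P >-> T}) (eta : probability T R) (h : T -> R) (r : R)
    (n k : nat) (A : nat -> set T) :
  iid X eta -> measurable_fun [set: T] h -> (forall x, 0 <= h x)%R ->
  \int[eta]_x (h x)%:E = r%:E -> (k <= n)%N ->
  (forall i, measurable (A i)) ->
  \int[P]_w (\prod_(i < n)
     (if (i < k)%N then h (X i w) else \1_(A i) (X i w)))%:E =
  (\prod_(i < n) (if (i < k)%N then r else fine (eta (A i))))%:E.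
Proof.
move=> [indep distr] mh h0 hr.
have r0 : (0 <= r)%R by rewrite -lee_fin -hr integral_ge0// => x _; rewrite lee_fin.
elim: k A => [|k IH] A kn mA.
  transitivity (\int[P]_w
      (\1_(\bigcap_(i in [set k | (k < n)%N]) (X i @^-1` A i)) w)%:E).
    by apply: eq_integral => w _; rewrite -prod_indic_bigcap.
  have mXA i : measurable (X i @^-1` A i).
    by rewrite -[X in measurable X]setTI; exact: measurable_funP.
  rewrite integral_indic//; last first.
    by apply: fin_bigcap_measurable => //; exact: finite_II.
  rewrite setIT; pose J := [fset i in iota 0 n]%fset.
  have -> : [set k | (k < n)%N] = [set` J].
    by apply/seteqP; split=> i /=; rewrite /J !inE mem_iota.
  transitivity (\prod_(i <- J) P (X i @^-1` A i)).
    exact: (indep J A (fun i _ => mA i)).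
  have -> : \prod_(i <- J) P (X i @^-1` A i) = \prod_(0 <= i < n) P (X i @^-1` A i).
    apply: perm_big; rewrite /index_iota subn0; apply: uniq_perm.
    - exact: fset_uniq.
    - exact: iota_uniq.
    - by move=> i; rewrite /J inE.
  rewrite big_mkord -prodEFin; apply: eq_bigr => i _.
  rewrite fineK ?fin_num_measure//.
  exact: (distr i (A i) (mA i)).
have kn' : (k < n)%N by [].
pose W w := (\prod_(i < n | i != Ordinal kn')
  (if (i < k)%N then h (X i w) else \1_(A i) (X i w)))%R.
pose c := (\prod_(i < n | i != Ordinal kn')
  (if (i < k)%N then r else fine (eta (A i))))%R.
have neqk (i : 'I_n) : i != Ordinal kn' -> (i < k.+1)%N = (i < k)%N.
  move=> ik; rewrite ltnS leq_eqVlt; case: eqP => // ik'.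
  by case/eqP: ik; exact: val_inj.
have EW : \int[P]_w (\prod_(i < n)
     (if (i < k.+1)%N then h (X i w) else \1_(A i) (X i w)))%:E =
     \int[P]_w ((h (X k w))%:E * (W w)%:E).
  apply: eq_integral => w _; rewrite (bigD1 (Ordinal kn'))//= ltnSn EFinM.
  congr (_ * _%:E); apply: eq_bigr => i ik.
  by rewrite neqk.
rewrite EW.
rewrite (@integral_transfer _ _ _ _ _ _ eta (X k) W c (EFin \o h))//.
- rewrite [LHS](_ : _ = c%:E * r%:E); last by congr (_ * _); exact: hr.
  rewrite -EFinM mulrC (bigD1 (Ordinal kn'))//= ltnSn.
  by congr (_ * _)%:E; apply: eq_bigr => i ik; rewrite neqk.
- rewrite /W; under eq_fun do rewrite big_mkcond/=.
  apply: measurable_prod => i _; case: (i != _) => //.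
  have mX : measurable_fun [set: Omega] (X i) by exact: measurable_funPT.
  case: (i < k)%N; first exact: (measurableT_comp mh mX).
  exact: (measurableT_comp (measurable_indic (mA i)) mX).
- by move=> w; apply: prodr_ge0 => i _; case: ifP.
- by apply: prodr_ge0 => i _; case: ifP => // _; exact: fine_ge0.
- move=> B mB.
  have {IH} := IH (fun i => if i == k then B else A i) (ltnW kn).
  have -> : \int[P]_w (\prod_(i < n)
     (if (i < k)%N then h (X i w) else \1_(if val i == k then B else A i) (X i w)))%:E =
     \int[P]_w (\1_B (X k w) * W w)%:E.
    apply: eq_integral => w _; rewrite (bigD1 (Ordinal kn'))//= ltnn eqxx.
    congr (_ * _)%:E; apply: eq_bigr => i ik.
    by rewrite (_ : (val i == k) = false)//; exact/negbTE.
  move=> ->; last by move=> i; case: ifP.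
  rewrite (bigD1 (Ordinal kn'))//= ltnn eqxx EFinM muleC.
  rewrite fineK ?fin_num_measure//; congr (_%:E * _).
  by apply: eq_bigr => i ik; rewrite (_ : (val i == k) = false)//; exact/negbTE.
- exact/measurable_EFin.
Qed.

Lemma expectation_prod_iid (R : realType) (d d' : measure_display)
    (Omega : measurableType d) (T : measurableType d') (P : probability Omega R)
    (X : nat -> {RV P >-> T}) (eta : probability T R) (h : T -> R) (r : R)
    (n : nat) :
  iid X eta -> measurable_fun [set: T] h -> (forall x, 0 <= h x)%R ->
  \int[eta]_x (h x)%:E = r%:E ->
  \int[P]_w (\prod_(i < n) h (X i w))%:E = (r ^+ n)%:E.
Proof.
move=> XX mh h0 hr.
have := @expectation_prod_partial _ _ _ _ _ P X eta h r n n (fun=> setT) XX mh h0 hr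
  (leqnn n) (fun=> measurableT).
rewrite [X in _ = X%:E -> _](eq_bigr (fun=> r)); last by move=> i _; rewrite ltn_ord.
rewrite prodr_const card_ord => <-; apply: eq_integral => w _.
by congr EFin; apply: eq_bigr => i _; rewrite ltn_ord.
Qed.

End product_expectation.

(** * Inequalities for the exponential and the inner product *)

Section expR_facts.
Variable R : realType.
Implicit Types s t x : R.

(** With [x = t * s]: [expR x - 1 - x <= x * (expR x - 1) <= x ^+ 2 * expR `|x|].
    As [`|t| <= 2^-1], half of the exponent [`|s|] is left over to absorb the
    factor [s ^+ 2], so that the error is quadratic in [t] and exponential in [s]. *)
Lemma expR_le_quadratic s t : `|t| <= 2^-1 ->
  expR (t * s) <= 1 + t * s + 16 * t ^+ 2 * (expR s + expR (- s)).
Proof.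
move=> t2; set x := t * s.
have xs : `|x| <= `|s| / 2.
  by rewrite normrM mulrC ler_wpM2l.
have E : expR `|s| <= expR s + expR (- s).
  have [s0|s0] := leP 0 s.
    by rewrite ger0_norm// lerDl expR_ge0.
  by rewrite ltr0_norm// lerDr expR_ge0.
have h1 : expR x - 1 <= x * expR x.
  have := expR_ge1Dx (- x); rewrite expRN => h.
  have := ler_wpM2l (expR_ge0 x) h; rewrite mulfV ?gt_eqF ?expR_gt0//.
  lra.
have h2 : `|expR x - 1| <= `|x| * expR `|x|.
  have [x0|x0] := leP 0 x.
    by rewrite !ger0_norm// subr_ge0 -expR0 ler_expR.
  have e1 : expR x <= 1 by rewrite -[leRHS]expR0 ler_expR ltW.
  have e2 : 1 <= expR (- x) by rewrite -[leLHS]expR0 ler_expR oppr_ge0 ltW.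
  rewrite (ltr0_norm x0)// ler0_norm ?subr_le0//.
  have := expR_ge1Dx x; nra.
have h3 : expR x - 1 - x <= `|x| ^+ 2 * expR `|x|.
  have : x * (expR x - 1) <= `|x| * (`|x| * expR `|x|).
    by rewrite (le_trans (ler_norm _))// normrM ler_wpM2l.
  lra.
have h4 : s ^+ 2 <= 16 * expR (`|s| / 2).
  have := expR_ge1Dx (`|s| / 4); have -> : `|s| / 2 = `|s| / 4 + `|s| / 4 by lra.
  rewrite expRD -(real_normK (num_real s)); have := normr_ge0 s.
  set a := `|s|; set e := expR _; nra.
have h5 : expR `|x| <= expR (`|s| / 2) by rewrite ler_expR.
have h6 : expR (`|s| / 2) * expR (`|s| / 2) = expR `|s| by rewrite -expRD -splitr.
have h7 : `|x| ^+ 2 * expR `|x| <= t ^+ 2 * (16 * expR (`|s| / 2)) * expR (`|s| / 2).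
  apply: ler_pM => //; rewrite ?exprn_ge0 ?expR_ge0//.
  by rewrite real_normK ?num_real// exprMn ler_wpM2l ?sqr_ge0.
rewrite -2!mulrA h6 in h7.
have : t ^+ 2 * (16 * expR `|s|) <= t ^+ 2 * (16 * (expR s + expR (- s))).
  by rewrite ler_wpM2l ?sqr_ge0// ler_wpM2l.
by move: h3 h7; set A := expR s + _; set B := t ^+ 2; rewrite -!/x; lra.
Qed.

Lemma norm_le_expR s : `|s| <= expR s + expR (- s).
Proof.
have := expR_ge1Dx s; have := expR_ge1Dx (- s).
have := expR_gt0 s; have := expR_gt0 (- s).
by rewrite ler_norml => *; apply/andP; split; lra.
Qed.

End expR_facts.

Section inner_facts.
Variables (R : realType) (m : nat).
Implicit Types u v : 'rV[R]_m.

Lemma inner0l v : inner 0 v = 0.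
Proof. by rewrite /inner big1// => i _; rewrite mxE mul0r. Qed.

Lemma innerDl u u' v : inner (u + u') v = inner u v + inner u' v.
Proof. by rewrite /inner -big_split/=; apply: eq_bigr => i _; rewrite mxE mulrDl. Qed.

Lemma innerC u v : inner u v = inner v u.
Proof. by apply: eq_bigr => i _; rewrite mulrC. Qed.

Lemma innerZl (t : R) u v : inner (t *: u) v = t * inner u v.
Proof. by rewrite /inner mulr_sumr; apply: eq_bigr => i _; rewrite mxE mulrA. Qed.

Lemma innerNl u v : inner (- u) v = - inner u v.
Proof. by rewrite -scaleN1r innerZl mulN1r. Qed.

Lemma inner_delta (j : 'I_m) v : inner (delta_mx 0 j) v = v 0 j.
Proof.
rewrite /inner (bigD1 j)//= mxE !eqxx mul1r big1 ?addr0// => i /negbTE ij.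
by rewrite mxE ij andbF mul0r.
Qed.

Lemma inner_suml (I : Type) (s : seq I) (F : I -> 'rV[R]_m) v :
  inner (\sum_(i <- s) F i) v = \sum_(i <- s) inner (F i) v.
Proof.
elim: s => [|a s IH]; first by rewrite !big_nil inner0l.
by rewrite !big_cons innerDl IH.
Qed.

Lemma innerDr u v v' : inner u (v + v') = inner u v + inner u v'.
Proof. by rewrite innerC innerDl !(innerC u). Qed.

Lemma innerZr (t : R) u v : inner u (t *: v) = t * inner u v.
Proof. by rewrite innerC innerZl innerC. Qed.

Lemma cvg_inner (I : Type) (F : set_system I) (f g : I -> 'rV[R]_m) u v :
  Filter F -> f @ F --> u -> g @ F --> v ->
  inner (f x) (g x) @[x --> F] --> inner u v.
Proof.
move=> FF fu gv; rewrite /inner; apply: cvg_big => //; first exact: add_continuous.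
move=> j _; apply: cvgM.
- exact: (cvg_comp _ _ fu (@coord_continuous _ _ _ 0 j u)).
- exact: (cvg_comp _ _ gv (@coord_continuous _ _ _ 0 j v)).
Qed.

(** The exponent is at most [m] times the largest [A * `|v 0 j|]. *)
Lemma expR_inner_le_box (A : R) u v : (forall j, `|u 0 j| <= A) ->
  expR (inner u v) <= 1 + \sum_(j < m)
    (expR (m%:R * A * v 0 j) + expR (- (m%:R * A * v 0 j))).
Proof.
move=> uA.
have le1 : inner u v <= \sum_(j < m) A * `|v 0 j|.
  apply: ler_sum => j _; rewrite (le_trans (ler_norm _))// normrM.
  by rewrite ler_wpM2r.
have sum0 : 0 <= \sum_(j < m)
    (expR (m%:R * A * v 0 j) + expR (- (m%:R * A * v 0 j))).
  by apply: sumr_ge0 => j _; rewrite addr_ge0 ?expR_ge0.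
have [[j hj]|/forallNP nj] :=
    pselect (exists j : 'I_m, inner u v <= m%:R * (A * `|v 0 j|)).
  have A0 : 0 <= A by rewrite (le_trans _ (uA j)).
  have : expR (inner u v) <=
      expR (m%:R * A * v 0 j) + expR (- (m%:R * A * v 0 j)).
    apply: (@le_trans _ _ (expR (m%:R * (A * `|v 0 j|)))); first by rewrite ler_expR.
    rewrite mulrA; have [v0|v0] := leP 0 (v 0 j).
      by rewrite ger0_norm// lerDl expR_ge0.
    by rewrite ltr0_norm// mulrN lerDr expR_ge0.
  rewrite (bigD1 j)//=.
  have : 0 <= \sum_(i < m | i != j)
    (expR (m%:R * A * v 0 i) + expR (- (m%:R * A * v 0 i))).
    by apply: sumr_ge0 => i _; rewrite addr_ge0 ?expR_ge0.
  lra.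
(* no coordinate dominates: possible only in dimension zero *)
have : inner u v <= 0.
  case: (posnP m) => [m0|m0].
    by rewrite (le_trans le1)// big1// => j _; have := ltn_ord j; rewrite {2}m0.
  exfalso.
  have {}nj j : m%:R * (A * `|v 0 j|) < inner u v by rewrite ltNge; apply/negP.
  have : \sum_(j < m) m%:R * (A * `|v 0 j|) < \sum_(j < m) inner u v.
    by apply: ltr_sum => //; apply/hasP; exists (Ordinal m0) => //; exact: mem_index_enum.
  rewrite -mulr_sumr sumr_const card_ord -[X in _ < X]mulr_natl ltr_pM2l ?ltr0n//.
  by rewrite ltNge le1.
rewrite -ler_expR expR0; lra.
Qed.

End inner_facts.

(** * Real-valued integrals and passages to the limit *)

Lemma integrable_EFinD (R : realType) (d : measure_display)
    (T : measurableType d) (mu : {measure set T -> \bar R}) (f g : T -> R) :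
  mu.-integrable setT (EFin \o f) -> mu.-integrable setT (EFin \o g) ->
  mu.-integrable setT (EFin \o (fun x => f x + g x)).
Proof. by move=> If Ig; exact: (integrableD measurableT If Ig). Qed.

Lemma integrable_EFinB (R : realType) (d : measure_display)
    (T : measurableType d) (mu : {measure set T -> \bar R}) (f g : T -> R) :
  mu.-integrable setT (EFin \o f) -> mu.-integrable setT (EFin \o g) ->
  mu.-integrable setT (EFin \o (fun x => f x - g x)).
Proof. by move=> If Ig; exact: (integrableB measurableT If Ig). Qed.

Lemma integrable_EFinZ (R : realType) (d : measure_display)
    (T : measurableType d) (mu : {measure set T -> \bar R}) (k : R) (f : T -> R) :
  mu.-integrable setT (EFin \o f) ->
  mu.-integrable setT (EFin \o (fun x => k * f x)).
Proof. by move=> If; exact: (integrableZl measurableT k If). Qed.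

Lemma integrable_EFin_cst (R : realType) (d : measure_display)
    (T : measurableType d) (P : probability T R) (k : R) :
  P.-integrable setT (EFin \o (fun=> k)).
Proof. exact: finite_measure_integrable_cst. Qed.

Lemma integrable_EFin_sum (R : realType) (d : measure_display)
    (T : measurableType d) (mu : {measure set T -> \bar R}) (I : Type)
    (s : seq I) (f : I -> T -> R) :
  (forall i, mu.-integrable setT (EFin \o f i)) ->
  mu.-integrable setT (EFin \o (fun x => \sum_(i <- s) f i x)).
Proof.
move=> If; rewrite (_ : _ \o _ = fun x => (\sum_(i <- s) (EFin \o f i) x)%E).
  by apply: integrable_sum => // i _; exact: If.
by apply/funext => x /=; rewrite sumEFin.
Qed.

Lemma Rintegral_sum (R : realType) (d : measure_display)
    (T : measurableType d) (mu : {measure set T -> \bar R}) (I : Type)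
    (s : seq I) (f : I -> T -> R) :
  (forall i, mu.-integrable setT (EFin \o f i)) ->
  \int[mu]_x (\sum_(i <- s) f i x) = \sum_(i <- s) \int[mu]_x f i x.
Proof.
move=> If; elim: s => [|i s IH].
  rewrite big_nil; under eq_Rintegral do rewrite big_nil.
  by rewrite /Rintegral integral0.
rewrite big_cons -IH -RintegralD//; last exact: integrable_EFin_sum.
by under eq_Rintegral do rewrite big_cons.
Qed.

Lemma le_integrable_EFin (R : realType) (d : measure_display)
    (T : measurableType d) (mu : {measure set T -> \bar R}) (f g : T -> R) :
  measurable_fun setT f -> (forall x, `|f x| <= g x) ->
  mu.-integrable setT (EFin \o g) -> mu.-integrable setT (EFin \o f).
Proof.
move=> mf fg; apply: le_integrable => //; first exact: measurable_EFin.
by move=> x _ /=; rewrite lee_fin (le_trans (fg x))// ler_norm.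
Qed.

Lemma Rintegral_prob_cst (R : realType) (d : measure_display)
    (T : measurableType d) (P : probability T R) (k : R) : \int[P]_x k = k.
Proof.
rewrite Rintegral_cst// -[RHS]mulr1; congr (_ * _).
exact: (congr1 fine (probability_setT P)).
Qed.

Lemma measurable_Rintegrable (R : realType) (d : measure_display)
    (T : measurableType d) (mu : {measure set T -> \bar R}) (f : T -> R) :
  mu.-integrable setT (EFin \o f) -> measurable_fun setT f.
Proof. by move=> /measurable_int /measurable_EFinP. Qed.

(** Truncate at height [L]: on the truncations dominated convergence applies,
    and since [f - min f L <= f ^ 2 / L] the truncation error is at most
    [K / L], uniformly along the sequence. *)
Lemma cvg_Rintegral_bounded_square (R : realType) (d : measure_display)
    (T : measurableType d) (P : probability T R) (f_ : nat -> T -> R)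
    (f : T -> R) (K : R) :
  (forall n, P.-integrable setT (EFin \o f_ n)) ->
  P.-integrable setT (EFin \o f) ->
  (forall n, P.-integrable setT (EFin \o (fun x => f_ n x ^+ 2))) ->
  P.-integrable setT (EFin \o (fun x => f x ^+ 2)) ->
  (forall n x, 0 <= f_ n x) -> (forall x, 0 <= f x) ->
  (forall n, \int[P]_x (f_ n x ^+ 2) <= K) -> \int[P]_x (f x ^+ 2) <= K ->
  (forall x, f_ n x @[n --> \oo] --> f x) ->
  \int[P]_x f_ n x @[n --> \oo] --> \int[P]_x f x.
Proof.
move=> If_ If If_2 If2 f_0 f0 f_K fK f_f.
have K0 : 0 <= K by apply: le_trans fK; apply: Rintegral_ge0 => x _; exact: sqr_ge0.
pose tr (L : R) (u : T -> R) x := Num.min (u x) L.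
have Itr L (u : T -> R) : 0 < L -> (forall x, 0 <= u x) ->
    P.-integrable setT (EFin \o u) -> P.-integrable setT (EFin \o tr L u).
  move=> L0 u0 Iu; apply: (@le_integrable_EFin _ _ _ _ _ u) => //.
    apply: measurable_minr => //; exact: measurable_Rintegrable Iu.
  by move=> x; rewrite /tr ger0_norm ?le_min ?u0 ?(ltW L0)// ge_min lexx.
have trunc L (u : T -> R) : 0 < L -> (forall x, 0 <= u x) ->
    P.-integrable setT (EFin \o u) ->
    P.-integrable setT (EFin \o (fun x => u x ^+ 2)) ->
    \int[P]_x (u x ^+ 2) <= K ->
    `|\int[P]_x u x - \int[P]_x tr L u x| <= L^-1 * K.
  move=> L0 u0 Iu Iu2 uK; rewrite -RintegralB//; last exact: Itr.
  have IB := integrable_EFinB Iu (Itr L u L0 u0 Iu).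
  rewrite ger0_norm; last first.
    by apply: Rintegral_ge0 => x _; rewrite subr_ge0 /tr ge_min lexx.
  apply: (@le_trans _ _ (L^-1 * \int[P]_x (u x ^+ 2))); last first.
    by rewrite ler_wpM2l// invr_ge0 ltW.
  rewrite -RintegralZl//; apply: le_Rintegral => //; first exact: integrable_EFinZ.
  move=> x _; rewrite /tr; case: (leP (u x) L) => uL.
    by rewrite subrr mulr_ge0 ?sqr_ge0// invr_ge0 ltW.
  rewrite ler_pdivlMl//; have := u0 x; nra.
have cvg_tr L : 0 < L -> \int[P]_x tr L (f_ n) x @[n --> \oo] -->
    \int[P]_x tr L f x.
  move=> L0; apply: fine_cvg; rewrite fineK; last first.
    by apply: integrable_fin_num => //; exact: Itr.
  apply: (@dominated_cvg _ _ _ P setT measurableT _ _ (fun=> L%:E)) => //.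
  - move=> n; apply: measurable_EFin; apply: measurable_Rintegrable.
    exact: (Itr L (f_ n)).
  - move=> x _; apply: cvg_EFin; first by near=> n.
    apply/cvgrPdist_lt => r r0; have /cvgrPdist_lt /(_ _ r0) := f_f x.
    apply: filterS => n; rewrite /tr/= !ltr_norml => /andP[? ?].
    by case: (leP (f x) L); case: (leP (f_ n x) L) => ? ?; apply/andP; split; lra.
  - exact: integrable_EFin_cst.
  - move=> n x _; rewrite abse_EFin lee_fin /tr ger0_norm ?le_min ?f_0 ?(ltW L0)//.
    by rewrite ge_min lexx orbT.
apply/cvgrPdist_lt => e e0.
pose L := 3 * K / e + 1.
have L0 : 0 < L by rewrite ltr_wpDl// divr_ge0 ?mulr_ge0// ltW.
have LK : L^-1 * K < e / 3.
  rewrite ltr_pdivrMl// /L mulrDl mul1r.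
  have -> : 3 * K / e * (e / 3) = K by field; rewrite gt_eqF.
  by rewrite ltrDl divr_gt0.
have e30 : 0 < e / 3 by rewrite divr_gt0.
have /cvgrPdist_lt /(_ _ e30) := cvg_tr L L0.
apply: filterS => n cn.
have h1 := trunc L f L0 f0 If If2 fK.
have h2 := trunc L (f_ n) L0 (f_0 n) (If_ n) (If_2 n) (f_K n).
move: h1 h2 cn; rewrite !ler_norml !ltr_norml => /andP[? ?] /andP[? ?] /andP[? ?].
by apply/andP; split; lra.
Unshelve. all: by end_near. Qed.

(** Closeness near a point of ['rV_n] can be tested on sequences, the topology
    being metric. *)
Lemma near_within_of_seq (R : realType) (n : nat) (D : set 'rV[R]_n)
    (f : 'rV[R]_n -> R) (a : 'rV[R]_n) (e : R) :
  (forall u : nat -> 'rV[R]_n, (forall k, D (u k)) ->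
     u k @[k --> \oo] --> a -> f (u k) @[k --> \oo] --> f a) ->
  0 < e -> \forall y \near a, D y -> `|f y - f a| < e.
Proof.
move=> seqc e0; apply: contrapT => nnear.
have /choice [u uP] (k : nat) : exists y,
    [/\ ball a k.+1%:R^-1 y, D y & e <= `|f y - f a|].
  apply: contrapT => /forallNP H; apply: nnear.
  apply/nbhs_ballP; exists k.+1%:R^-1 => /=; first by rewrite invr_gt0.
  move=> y ay Dy; rewrite ltNge; apply/negP => ey.
  by apply: (H y).
have ua : u k @[k --> \oo] --> a.
  apply/cvg_ballP => r r0.
  have := near_infty_natSinv_lt (PosNum r0); apply: filterS => k /= kr.
  by case: (uP k) => + _ _; apply: le_ball; exact: ltW.
have := seqc u (fun k => let: And3 _ Dk _ := uP k in Dk) ua.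
move=> /cvgrPdist_lt /(_ _ e0) [N _ /(_ N (leqnn N))]/=.
by case: (uP N) => _ _; rewrite distrC leNgt => /negP.
Qed.

(** * Moment generating functions *)

(** The standing assumption on [Y]: measurability is required coordinatewise, so
    that no measurable structure on the row vectors is involved. *)
Definition has_exp_moments (R : realType) (d : measure_display)
    (T : measurableType d) (m : nat) (eta : probability T R)
    (Y : T -> 'rV[R]_m) : Prop :=
  (forall j, measurable_fun setT (fun x => Y x 0 j)) /\
  (forall a, eta.-integrable setT (EFin \o (fun x => expR (inner a (Y x))))).

Definition mgf (R : realType) (d : measure_display) (T : measurableType d)
    (m : nat) (eta : probability T R) (Y : T -> 'rV[R]_m) (a : 'rV[R]_m) : R :=
  \int[eta]_x expR (inner a (Y x)).

Definition log_mgf (R : realType) (d : measure_display) (T : measurableType d)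
    (m : nat) (eta : probability T R) (Y : T -> 'rV[R]_m) (a : 'rV[R]_m) : R :=
  ln (mgf eta Y a).

(** The gradient of [log_mgf] at [a]; equivalently the mean of [Y] under the
    probability with [eta]-density proportional to [expR (inner a (Y x))]. *)
Definition tilted_mean (R : realType) (d : measure_display)
    (T : measurableType d) (m : nat) (eta : probability T R)
    (Y : T -> 'rV[R]_m) (a : 'rV[R]_m) : 'rV[R]_m :=
  \row_j ((\int[eta]_x (Y x 0 j * expR (inner a (Y x)))) / mgf eta Y a).

Section mgf_theory.
Variables (R : realType) (d : measure_display) (T : measurableType d).
Variables (m : nat) (eta : probability T R) (Y : T -> 'rV[R]_m).
Hypothesis YE : has_exp_moments eta Y.

Local Notation M := (mgf eta Y).
Local Notation Lam := (log_mgf eta Y).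
Local Notation mean := (tilted_mean eta Y).

Let mY j : measurable_fun setT (fun x => Y x 0 j).
Proof. by case: YE. Qed.

Let IY a : eta.-integrable setT (EFin \o (fun x => expR (inner a (Y x)))).
Proof. by case: YE. Qed.

Lemma measurable_inner a : measurable_fun setT (fun x => inner a (Y x)).
Proof.
rewrite /inner; apply: measurable_sum => j.
by apply: measurable_funM.
Qed.

Lemma measurable_expR_inner a :
  measurable_fun setT (fun x => expR (inner a (Y x))).
Proof. by apply: measurableT_comp => //; exact: measurable_inner. Qed.

Lemma expR_inner_shift a t j x :
  expR (inner (a + t *: delta_mx 0 j) (Y x)) =
  expR (inner a (Y x)) * expR (t * Y x 0 j).
Proof. by rewrite innerDl innerZl inner_delta expRD. Qed.

Lemma expR_inner_shift1 a j x :
  expR (inner (a + delta_mx 0 j) (Y x)) =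
  expR (inner a (Y x)) * expR (Y x 0 j).
Proof. by rewrite innerDl inner_delta expRD. Qed.

Lemma expR_inner_shiftN1 a j x :
  expR (inner (a - delta_mx 0 j) (Y x)) =
  expR (inner a (Y x)) * expR (- Y x 0 j).
Proof. by rewrite innerDl innerNl inner_delta expRD. Qed.

Lemma integrable_coord_expR a j :
  eta.-integrable setT (EFin \o (fun x => Y x 0 j * expR (inner a (Y x)))).
Proof.
have I2 := integrable_EFinD (IY (a + delta_mx 0 j)) (IY (a - delta_mx 0 j)).
apply: (le_integrable_EFin _ _ I2).
  by apply: measurable_funM => //; exact: measurable_expR_inner.
move=> x; rewrite expR_inner_shift1 expR_inner_shiftN1 -mulrDr mulrC normrM.
by rewrite gtr0_norm ?expR_gt0// ler_wpM2l ?expR_ge0// norm_le_expR.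
Qed.

Lemma integrable_coord j : eta.-integrable setT (EFin \o (fun x => Y x 0 j)).
Proof.
have := integrable_coord_expR 0 j; apply: eq_integrable => // x _ /=.
by rewrite inner0l expR0 mulr1.
Qed.

Lemma mgf0 : M 0 = 1.
Proof.
rewrite /mgf; under eq_Rintegral do rewrite inner0l expR0.
exact: Rintegral_prob_cst.
Qed.

(** Jensen's inequality for [expR]. *)
Lemma expR_inner_mean_le_mgf a : expR (inner a (mean 0)) <= M a.
Proof.
have Ic : eta.-integrable setT (EFin \o (fun x => inner a (Y x))).
  by apply: integrable_EFin_sum => j; apply: integrable_EFinZ; exact: integrable_coord.
set c := inner a _.
have cE : \int[eta]_x inner a (Y x) = c.
  rewrite /inner Rintegral_sum; last first.
    by move=> j; apply: integrable_EFinZ; exact: integrable_coord.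
  apply: eq_bigr => j _; rewrite RintegralZl//; last exact: integrable_coord.
  rewrite mxE mgf0 divr1; congr (_ * _).
  by apply: eq_Rintegral => x _; rewrite inner0l expR0 mulr1.
have : \int[eta]_x (expR c * (1 + (inner a (Y x) - c))) <= M a.
  apply: le_Rintegral => //.
    apply: integrable_EFinZ; apply: integrable_EFinD; first exact: integrable_EFin_cst.
    by apply: integrable_EFinB => //; exact: integrable_EFin_cst.
  move=> x _.
  have -> : expR (inner a (Y x)) = expR c * expR (inner a (Y x) - c).
    by rewrite -expRD addrC subrK.
  by rewrite ler_pM2l ?expR_gt0//; exact: expR_ge1Dx.
rewrite RintegralZl//; last first.
  apply: integrable_EFinD; first exact: integrable_EFin_cst.
  by apply: integrable_EFinB => //; exact: integrable_EFin_cst.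
rewrite RintegralD//; last 2 first.
- exact: integrable_EFin_cst.
- by apply: integrable_EFinB => //; exact: integrable_EFin_cst.
rewrite RintegralB//; last exact: integrable_EFin_cst.
by rewrite cE !Rintegral_prob_cst subrr addr0 mulr1.
Qed.

Lemma mgf_gt0 a : 0 < M a.
Proof. exact: lt_le_trans (expR_gt0 _) (expR_inner_mean_le_mgf a). Qed.

Lemma log_mgf0 : Lam 0 = 0.
Proof. by rewrite /log_mgf mgf0 ln1. Qed.

Lemma expR_log_mgf a : expR (Lam a) = M a.
Proof. by rewrite lnK// posrE mgf_gt0. Qed.

Lemma inner_mean_le_log_mgf a : inner a (mean 0) <= Lam a.
Proof. by rewrite -ler_expR expR_log_mgf expR_inner_mean_le_mgf. Qed.

(** Integrate [expR_le_quadratic], then use [1 + u <= expR u]. Taken for both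
    signs of [t], this bound identifies [tilted_mean] as the gradient at a
    minimum, and it gives the exponential decay in Chernoff's inequality. *)
Lemma log_mgf_le_quadratic a j : exists2 K, 0 <= K & forall t, `|t| <= 2^-1 ->
  Lam (a + t *: delta_mx 0 j) <= Lam a + t * mean a 0 j + K * t ^+ 2.
Proof.
pose D := \int[eta]_x (Y x 0 j * expR (inner a (Y x))).
pose C := M (a + delta_mx 0 j) + M (a - delta_mx 0 j).
have C0 : 0 <= C by rewrite addr_ge0// ltW// mgf_gt0.
have Ma := mgf_gt0 a.
exists (16 * C / M a).
  by rewrite divr_ge0 ?mulr_ge0// ltW.
move=> t t2.
have I1 := integrable_EFinD (IY a) (integrable_EFinZ t (integrable_coord_expR a j)).
have I2 := integrable_EFinD (IY (a + delta_mx 0 j)) (IY (a - delta_mx 0 j)).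
have MC : M (a + t *: delta_mx 0 j) <= M a + t * D + 16 * t ^+ 2 * C.
  have -> : M a + t * D + 16 * t ^+ 2 * C = \int[eta]_x
     ((expR (inner a (Y x)) + t * (Y x 0 j * expR (inner a (Y x)))) +
      16 * t ^+ 2 * (expR (inner (a + delta_mx 0 j) (Y x)) +
                     expR (inner (a - delta_mx 0 j) (Y x)))).
    rewrite RintegralD//; last exact: integrable_EFinZ.
    rewrite RintegralD//; last by apply: integrable_EFinZ; exact: integrable_coord_expR.
    rewrite RintegralZl//; last exact: integrable_coord_expR.
    by rewrite RintegralZl// RintegralD.
  apply: le_Rintegral => //.
    by apply: integrable_EFinD => //; exact: integrable_EFinZ.
  move=> x _; rewrite expR_inner_shift expR_inner_shift1 expR_inner_shiftN1.
  apply: (le_trans (ler_wpM2l (expR_ge0 (inner a (Y x)))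
    (expR_le_quadratic (Y x 0 j) t2))).
  by rewrite le_eqVlt; apply/orP; left; apply/eqP; ring.
rewrite -ler_expR -addrA expRD !expR_log_mgf (le_trans MC)//.
have -> : M a + t * D + 16 * t ^+ 2 * C =
    M a * (1 + (t * mean a 0 j + 16 * C / M a * t ^+ 2)).
  by rewrite /tilted_mean mxE -/D; field; rewrite gt_eqF.
by rewrite ler_pM2l//; exact: expR_ge1Dx.
Qed.

End mgf_theory.

(** * Regularised minimisation of the log-moment generating function *)

Lemma expR_inner_sqr (R : realType) (m : nat) (a y : 'rV[R]_m) :
  expR (inner a y) ^+ 2 = expR (inner (2 *: a) y).
Proof. by rewrite innerZl -expRM_natl. Qed.

(** The integrands are squares of integrands of the same kind at half the argument,
    so bounds on the values at [2 *: a] give uniform integrability. *)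
Lemma cvg_mgf (R : realType) (d : measure_display) (T : measurableType d)
    (m : nat) (eta : probability T R) (Y_ : nat -> T -> 'rV[R]_m)
    (Y : T -> 'rV[R]_m) (a_ : nat -> 'rV[R]_m) (a : 'rV[R]_m) (K : R) :
  (forall n, has_exp_moments eta (Y_ n)) -> has_exp_moments eta Y ->
  (forall n, mgf eta (Y_ n) (2 *: a_ n) <= K) -> mgf eta Y (2 *: a) <= K ->
  a_ n @[n --> \oo] --> a -> (forall x, Y_ n x @[n --> \oo] --> Y x) ->
  mgf eta (Y_ n) (a_ n) @[n --> \oo] --> mgf eta Y a.
Proof.
move=> YE_ YE YK_ YK aa YY.
apply: (@cvg_Rintegral_bounded_square _ _ _ _ _ _ K).
- by move=> n; case: (YE_ n).
- by case: YE.
- by move=> n; under eq_fun do rewrite expR_inner_sqr; case: (YE_ n).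
- by under eq_fun do rewrite expR_inner_sqr; case: YE.
- by move=> n x; exact: expR_ge0.
- by move=> x; exact: expR_ge0.
- by move=> n; under eq_Rintegral do rewrite expR_inner_sqr; exact: YK_.
- by under eq_Rintegral do rewrite expR_inner_sqr; exact: YK.
- move=> x.
  exact: (continuous_cvg _ (@continuous_expR R _) (cvg_inner _ aa (YY x))).
Qed.

Section minimisation.
Variables (R : realType) (d : measure_display) (T : measurableType d).
Variables (m : nat) (eta : probability T R) (Y : T -> 'rV[R]_m).
Hypothesis YE : has_exp_moments eta Y.

Local Notation M := (mgf eta Y).
Local Notation Lam := (log_mgf eta Y).
Local Notation mean := (tilted_mean eta Y).

Lemma mgf_bounded_box (A : R) :
  exists K, forall u : 'rV[R]_m, (forall j, `|u 0 j| <= A) -> M u <= K.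
Proof.
have IY a : eta.-integrable setT (EFin \o (fun x => expR (inner a (Y x)))).
  by case: YE.
have I1 j : eta.-integrable setT (EFin \o (fun x =>
    expR (m%:R * A * Y x 0 j) + expR (- (m%:R * A * Y x 0 j)))).
  have := integrable_EFinD (IY ((m%:R * A) *: delta_mx 0 j))
                           (IY (- ((m%:R * A) *: delta_mx 0 j))).
  by apply: eq_integrable => // x _ /=; rewrite innerNl innerZl inner_delta.
exists (\int[eta]_x (1 + \sum_(j < m)
    (expR (m%:R * A * Y x 0 j) + expR (- (m%:R * A * Y x 0 j))))).
move=> u uA; apply: le_Rintegral => //.
  by apply: integrable_EFinD; [exact: integrable_EFin_cst|exact: integrable_EFin_sum].
by move=> x _; exact: expR_inner_le_box.
Qed.

(** Near [a] the values at [2 *: u] are bounded by [mgf_bounded_box]. *)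
Lemma mgf_continuous : continuous M.
Proof.
move=> a; have Fa : Filter (nbhs a) by exact: nbhs_filter.
apply: (iffRL (cvgrPdist_lt (F := nbhs a) M (M a))) => e e0.
pose A := \sum_(j < m) `|a 0 j| + 1.
have aA j : `|a 0 j| <= A - 1.
  rewrite /A addrK (bigD1 j)//= lerDl; exact: sumr_ge0.
have nA : nbhs a [set u : 'rV[R]_m | forall j, `|u 0 j| <= A].
  apply/nbhs_ballP; exists 1 => //= u [_ au] j.
  have := aA j; have := au 0 j; rewrite /ball/=.
  rewrite ltr_norml !ler_norml => /andP[? ?] /andP[? ?].
  by apply/andP; split; lra.
have [K MK] := mgf_bounded_box (2 * A).
have : nbhs a [set y : 'rV[R]_m | (forall j, `|y 0 j| <= A) -> `|M y - M a| < e].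
  apply: (@near_within_of_seq _ _ [set u : 'rV[R]_m | forall j, `|u 0 j| <= A]) => //.
  move=> u uA ua.
  apply: (@cvg_mgf _ _ _ _ _ (fun=> Y) Y u a K) => //.
  - move=> k; apply: MK => j; rewrite mxE normrM ger0_norm// ler_wpM2l//.
    exact: uA.
  - apply: MK => j; rewrite mxE normrM ger0_norm// ler_wpM2l//.
    by have := aA j; lra.
  - by move=> x; exact: cvg_cst.
by apply: filterS2 nA => y h1 h2; rewrite distrC; exact: h2.
Qed.

Lemma log_mgf_continuous : continuous Lam.
Proof.
move=> a; apply: continuous_comp; first exact: mgf_continuous.
exact: continuous_ln (mgf_gt0 YE a).
Qed.

(** Every point [b] is, up to a small error, the mean of an exponential tilt:
    minimise the coercive function
    [a |-> log_mgf a - inner a b + delta / 2 * inner a a]. At a minimiser the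
    first order condition is the first claim, and comparison with the value at
    [0] is the second. *)
Lemma regularized_minimiser (b : 'rV[R]_m) (delta : R) : 0 < delta ->
  exists a, mean a = b - delta *: a /\
            delta / 2 * inner a a <= inner a b - Lam a.
Proof.
move=> delta0.
pose F a := Lam a - inner a b + delta / 2 * inner a a.
have cF : continuous F.
  move=> a; have Fa : Filter (nbhs a) by exact: nbhs_filter.
  have c1 : inner x b @[x --> a] --> inner a b.
    exact: (cvg_inner Fa (@cvg_id _ (nbhs a)) (@cvg_cst _ b _ (nbhs a) Fa)).
  have c2 : inner x x @[x --> a] --> inner a a.
    exact: (cvg_inner Fa (@cvg_id _ (nbhs a)) (@cvg_id _ (nbhs a))).
  exact: (cvgD (cvgB (@log_mgf_continuous a) c1) (cvgM (cvg_cst (delta / 2)) c2)).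
pose c := mean 0 - b.
pose S := \sum_(j < m) c 0 j ^+ 2.
have S0 : 0 <= S by apply: sumr_ge0 => j _; exact: sqr_ge0.
pose A := 4 * S / delta ^+ 2 + 1.
have A1 : 1 <= A.
  rewrite /A lerDr divr_ge0 ?sqr_ge0// mulr_ge0//.
(* By Jensen, F is at least a quadratic function with gradient c at 0; completing
   squares shows that this is positive once a coordinate exceeds A. *)
have coercive (a : 'rV[R]_m) j : A < `|a 0 j| -> 0 < F a.
  move=> Aa.
  have le1 : inner a c + delta / 2 * inner a a <= F a.
    rewrite /F /c -scaleN1r innerDr innerZr.
    by have := inner_mean_le_log_mgf YE a; lra.
  apply: lt_le_trans le1.
  have le2 : \sum_(i < m) (delta / 4 * a 0 i ^+ 2 - c 0 i ^+ 2 / delta) <=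
      inner a c + delta / 2 * inner a a.
    rewrite /inner mulr_sumr -big_split/=; apply: ler_sum => i _.
    rewrite -subr_ge0.
    have -> : a 0 i * c 0 i + delta / 2 * (a 0 i * a 0 i) -
      (delta / 4 * a 0 i ^+ 2 - c 0 i ^+ 2 / delta) =
      (delta * a 0 i / 2 + c 0 i) ^+ 2 / delta by field; rewrite gt_eqF.
    by rewrite divr_ge0 ?sqr_ge0// ltW.
  apply: lt_le_trans le2; rewrite sumrB -mulr_suml -/S -mulr_sumr subr_gt0.
  have le3 : A < \sum_(i < m) a 0 i ^+ 2.
    rewrite (bigD1 j)//=; apply: ltr_wpDr.
      by apply: sumr_ge0 => i _; exact: sqr_ge0.
    rewrite -(real_normK (num_real (a 0 j))).
    by move: Aa; set x := `|_|; move: A1; nra.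
  apply: (@lt_le_trans _ _ (delta / 4 * A)); last first.
    apply: ler_wpM2l; last exact: ltW.
    by rewrite divr_ge0// ltW.
  rewrite /A mulrDr mulr1.
  have -> : delta / 4 * (4 * S / delta ^+ 2) = S / delta by field; rewrite gt_eqF.
  by rewrite ltrDl divr_gt0.
have F0 : F 0 = 0.
  by rewrite /F log_mgf0// !inner0l mulr0 addr0 subr0.
pose box := [set v : 'rV[R]_m | forall j, `[- A, A]%classic (v ord0 j)].
have [a aB amin] : exists2 a, a \in box & forall t, t \in box -> F a <= F t.
  apply: compact_EVT_min.
  - by exists 0 => j; rewrite /= mxE in_itv/=; apply/andP; split; lra.
  - apply: (@rV_compact R m (fun=> `[- A, A]%classic)) => j.
    exact: segment_compact.
  - exact: continuous_subspaceT.
have gmin (t : 'rV[R]_m) : F a <= F t.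
  have [tB|] := pselect (forall j, `[- A, A]%classic (t ord0 j)).
    by apply: amin; rewrite inE.
  move=> /existsNP [j tj].
  have Ft : 0 < F t.
    apply: (@coercive t j); rewrite ltNge; apply/negP => tA; apply: tj.
    by rewrite /= in_itv/= -ler_norml.
  apply: (le_trans _ (ltW Ft)); rewrite -F0; apply: amin.
  by rewrite inE => j' /=; rewrite mxE in_itv/=; apply/andP; split; lra.
exists a; split; last by have := gmin 0; rewrite F0 /F; lra.
apply/rowP => j; rewrite mxE [in RHS]mxE [in RHS]mxE [in RHS]mxE.
have [K K0 HK] := log_mgf_le_quadratic YE a j.
pose q := mean a 0 j - b 0 j + delta * a 0 j.
have quad t : `|t| <= 2^-1 -> 0 <= t * q + (K + delta / 2) * t ^+ 2.
  move=> /HK; have := gmin (a + t *: delta_mx 0 j); rewrite /F.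
  rewrite !innerDl !innerDr !innerZl !innerZr (innerC a (delta_mx _ _)).
  have -> : inner (delta_mx 0 j) (delta_mx 0 j : 'rV[R]_m) = 1.
    by rewrite inner_delta mxE !eqxx.
  by rewrite !inner_delta /q; nra.
suff : q = 0 by rewrite /q mxE; lra.
have K1 : 0 < K + delta / 2 by rewrite ltr_wpDl// divr_gt0.
apply/eqP/negPn/negP => q0.
(* a step of size s against the sign of q would make F smaller than at a *)
have absq : 0 < `|q| by rewrite normr_gt0.
pose s := Num.min 2^-1 (`|q| / 2 / (K + delta / 2)).
have s0 : 0 < s by rewrite /s lt_min invr_gt0 ltr0n/= !divr_gt0.
have s2 : s <= 2^-1 by rewrite /s ge_min lexx.
have sq : (K + delta / 2) * s <= `|q| / 2.
  by rewrite -ler_pdivlMl// [_^-1 * _]mulrC /s ge_min lexx orbT.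
have [q1|q1] := leP 0 q.
  have := quad (- s); rewrite normrN gtr0_norm// => /(_ s2).
  rewrite ger0_norm// in sq absq; nra.
have := quad s; rewrite gtr0_norm// => /(_ s2).
by rewrite ltr0_norm// in sq absq; nra.
Qed.

End minimisation.

(** * Densities and relative entropy *)

Section density.
Local Open Scope ereal_scope.
Variables (R : realType) (d : measure_display) (T : measurableType d).
Variables (eta : probability T R) (w : T -> R).
Hypothesis mw : measurable_fun [set: T] w.
Hypothesis w0 : forall x, (0 <= w x)%R.

Section density_prob.
Hypothesis w1 : \int[eta]_x (w x)%:E = 1.

Definition density_prob (A : set T) : \bar R := \int[eta]_(x in A) (w x)%:E.

Let density_prob0 : density_prob set0 = 0.
Proof. by rewrite /density_prob integral_set0. Qed.

Let density_prob_ge0 A : 0 <= density_prob A.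
Proof. by apply: integral_ge0 => x _; rewrite lee_fin. Qed.

Let density_prob_sigma_additive : semi_sigma_additive density_prob.
Proof.
move=> /= F mF tF mUF; rewrite /density_prob; apply: cvg_toP.
  apply: ereal_nondecreasing_is_cvgn => m n mn.
  by apply: lee_sum_nneg_natr => // k _ _; exact: density_prob_ge0.
rewrite ge0_integral_bigcup//=.
- by apply/measurable_funTS; exact: measurable_EFin.
- by move=> x _; rewrite lee_fin.
Qed.

HB.instance Definition _ := isMeasure.Build _ _ _ density_prob
  density_prob0 density_prob_ge0 density_prob_sigma_additive.

Let density_prob_setT : density_prob [set: T] = 1.
Proof. exact: w1. Qed.

HB.instance Definition _ :=
  Measure_isProbability.Build _ _ _ density_prob density_prob_setT.

Lemma exists_density_prob : exists nu : probability T R,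
  forall A, measurable A -> nu A = \int[eta]_(x in A) (w x)%:E.
Proof. by exists density_prob. Qed.

End density_prob.

Variable nu : probability T R.
Hypothesis nuE : forall A, measurable A -> nu A = \int[eta]_(x in A) (w x)%:E.

Lemma ge0_integral_density (h : T -> \bar R) :
  measurable_fun [set: T] h -> (forall x, 0 <= h x) ->
  \int[nu]_x h x = \int[eta]_x (h x * (w x)%:E).
Proof.
move=> mh h0; rewrite (@integral_transfer _ _ _ _ _ eta nu id w 1%R h)//.
  by rewrite mul1e.
move=> A mA; rewrite mul1e; apply/esym; etransitivity; first exact: nuE.
rewrite (integral_mkcond A) epatch_indic.
by apply: eq_integral => x _ /=; rewrite -EFinM mulrC.
Qed.

Lemma density_dominates : nu `<< eta.
Proof.
apply/null_content_dominatesP => A mA A0; etransitivity; first exact: nuE.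
by apply: null_set_integral => //; apply/measurable_funTS/measurable_EFin.
Qed.

Lemma Rintegral_density (f : T -> R) : measurable_fun [set: T] f ->
  eta.-integrable setT (fun x => (f x * w x)%:E) ->
  nu.-integrable setT (EFin \o f) /\
  (\int[nu]_x f x = \int[eta]_x (f x * w x))%R.
Proof.
move=> mf fw.
have mEf : measurable_fun setT (EFin \o f) by exact: measurable_EFin.
have If : nu.-integrable setT (EFin \o f).
  apply/integrableP; split => //; rewrite ge0_integral_density//; last first.
    exact: measurableT_comp.
  case/integrableP : fw => _; apply: le_lt_trans; rewrite le_eqVlt.
  apply/orP; left; apply/eqP; apply: eq_integral => x _ /=.
  by rewrite -EFinM normrM (ger0_norm (w0 x)).
split => //; rewrite /Rintegral; congr fine.
rewrite integralE [RHS]integralE; congr (_ - _).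
- rewrite ge0_integral_density//; last exact: measurable_funepos.
  apply: eq_integral => x _; rewrite !funeposE /= -!EFin_max -EFinM.
  by rewrite maxr_pMl// mul0r.
- rewrite ge0_integral_density//; last exact: measurable_funeneg.
  apply: eq_integral => x _; rewrite !funenegE /= -!EFin_max -EFinM.
  by rewrite maxr_pMl// mul0r mulNr.
Qed.

(** The set where the density vanishes is null for [nu], though possibly not for
    [eta]; this is what makes logarithms of densities harmless under [nu]. *)
Lemma density_pos_ae : {ae nu, forall x, (0 < w x)%R}.
Proof.
have mN : measurable [set x | (w x <= 0)%R].
  rewrite (_ : mkset _ = [set: T] `&` w @^-1` `]-oo, 0%R]); first exact: mw.
  by rewrite setTI; apply/seteqP; split => x /=; rewrite in_itv.
exists [set x | (w x <= 0)%R]; split => //.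
- etransitivity; first exact: nuE.
  rewrite -[RHS](integral0 eta [set x | (w x <= 0)%R]).
  apply: eq_integral => x; rewrite inE /= => wx; congr EFin.
  by apply/eqP; rewrite eq_le wx w0.
- by move=> x /=; rewrite ltNge => /negP; rewrite negbK.
Qed.

(** On finite values [lne] is a case distinction between measurable functions. *)
Lemma measurable_lne_comp (f : T -> \bar R) : measurable_fun [set: T] f ->
  (forall x, f x \is a fin_num) -> measurable_fun [set: T] (fun x => lne (f x)).
Proof.
move=> mf ff.
have mff : measurable_fun [set: T] (fun x => fine (f x)) by exact: measurableT_comp.
rewrite (_ : (fun x => lne (f x)) =
  (fun x => if (fine (f x) <= 0)%R then -oo else (ln (fine (f x)))%:E)).
  apply: measurable_fun_ifT => //.
    exact: measurable_fun_ler.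
  by apply: measurable_EFin; exact: measurableT_comp.
by apply/funext => x; rewrite -[in LHS](fineK (ff x)).
Qed.

Lemma relative_entropy_density :
  relative_entropy nu eta = \int[nu]_x (ln (w x))%:E.
Proof.
have dom := density_dominates.
rewrite /relative_entropy asboolT//.
set f := Radon_Nikodym _ _.
have If : eta.-integrable setT f by exact: Radon_Nikodym_integrable.
have mf : measurable_fun setT f by exact: measurable_int If.
have fw : ae_eq eta setT f (fun x => (w x)%:E).
  apply: integral_ae_eq => //; first exact: measurable_EFin.
  move=> E _ mE; apply/esym; etransitivity; first by apply/esym; exact: nuE.
  exact: (@Radon_Nikodym_integral _ _ _ (charge_of_finite_measure nu) eta).
apply: ae_eq_integral => //.
- apply: measurable_lne_comp => // x; exact: Radon_Nikodym_fin_num.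
- by apply: measurable_EFin; exact: measurableT_comp.
have := null_dominates_ae_eq measurableT dom fw.
move: density_pos_ae; apply: filterS2 => x wx /(_ I) fx _.
by rewrite fx lne_EFin.
Qed.

End density.

(** * Exponential tilts and the Donsker-Varadhan inequality *)

Lemma Rintegral_EFin (R : realType) (d : measure_display)
    (T : measurableType d) (mu : {measure set T -> \bar R}) (f : T -> R) :
  mu.-integrable setT (EFin \o f) ->
  (\int[mu]_x (f x)%:E)%E = (\int[mu]_x f x)%:E.
Proof. by move=> If; rewrite /Rintegral fineK//; exact: integrable_fin_num. Qed.

Section exponential_tilt.
Variables (R : realType) (d : measure_display) (T : measurableType d).
Variables (m : nat) (eta : probability T R) (Y : T -> 'rV[R]_m).
Hypothesis YE : has_exp_moments eta Y.

Local Notation M := (mgf eta Y).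
Local Notation Lam := (log_mgf eta Y).
Local Notation mean := (tilted_mean eta Y).

Lemma Rintegral_inner (nu : probability T R) a :
  (forall j, nu.-integrable setT (EFin \o (fun x => Y x 0 j))) ->
  nu.-integrable setT (EFin \o (fun x => inner a (Y x))) /\
  \int[nu]_x inner a (Y x) = inner a (vec_integral nu Y).
Proof.
move=> IY; have IZ j : nu.-integrable setT (EFin \o (fun x => a 0 j * Y x 0 j)).
  exact: integrable_EFinZ.
split; first exact: (integrable_EFin_sum _ IZ).
rewrite /inner Rintegral_sum//; apply: eq_bigr => j _.
by rewrite RintegralZl// mxE.
Qed.

Lemma exponential_tilt a : exists nu : probability T R,
  vec_integral nu Y = mean a /\
  relative_entropy nu eta = (inner a (mean a) - Lam a)%:E.
Proof.
pose w x := expR (inner a (Y x)) / M a.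
have M0 := mgf_gt0 YE a.
have Ia : eta.-integrable setT (EFin \o (fun x => expR (inner a (Y x)))).
  by case: YE.
have mw : measurable_fun [set: T] w.
  by apply: measurable_funM => //; exact: (measurable_expR_inner YE a).
have w0 x : 0 <= w x by rewrite divr_ge0 ?expR_ge0// ltW.
have w1 : (\int[eta]_x (w x)%:E = 1)%E.
  rewrite (Rintegral_EFin (f := w)).
    by rewrite RintegralZr// divff ?gt_eqF.
  have := integrable_EFinZ (M a)^-1 Ia; apply: eq_integrable => // x _.
  by rewrite /= mulrC.
have [nu nuE] := exists_density_prob mw w0 w1.
have IYw j : eta.-integrable setT (fun x => (Y x 0 j * w x)%:E).
  have := integrable_EFinZ (M a)^-1 (integrable_coord_expR YE a j).
  by apply: eq_integrable => // x _; rewrite /= /w; congr EFin; ring.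
have mY j : measurable_fun [set: T] (fun x => Y x 0 j) by case: YE.
have IY j : nu.-integrable setT (EFin \o (fun x => Y x 0 j)).
  by have [] := Rintegral_density mw w0 nuE (mY j) (IYw j).
have meanE : vec_integral nu Y = mean a.
  apply/rowP => j; rewrite !mxE.
  have [_ ->] := Rintegral_density mw w0 nuE (mY j) (IYw j).
  rewrite -RintegralZr//; last exact: integrable_coord_expR.
  by apply: eq_Rintegral => x _; rewrite /w mulrA.
exists nu; split => //.
have [Iinner innerE] := Rintegral_inner a IY.
rewrite (relative_entropy_density mw w0 nuE).
transitivity (\int[nu]_x (inner a (Y x) - Lam a)%:E)%E.
  apply: eq_integral => x _; rewrite /w ln_div ?posrE ?expR_gt0//.
  by rewrite expRK.
rewrite (Rintegral_EFin (f := fun x => inner a (Y x) - Lam a)); last first.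
  by apply: integrable_EFinB => //; exact: integrable_EFin_cst.
rewrite RintegralB//; last exact: integrable_EFin_cst.
by rewrite Rintegral_prob_cst innerE meanE.
Qed.

End exponential_tilt.

Lemma norm_le_of_two_sided (R : realType) (y l a b u v : R) :
  y - a - l <= u - 1 -> - y - b - l <= v - 1 -> 0 <= u -> 0 <= v ->
  `|y| <= `|l| + (`|a| + `|b|) + (u + v).
Proof.
move=> h1 h2 u0 v0; rewrite ler_norml.
have := ler_norm l; have := ler_norm a; have := ler_norm b.
have := normr_ge0 a; have := normr_ge0 b.
by move=> *; apply/andP; split; lra.
Qed.

Section donsker_varadhan.
Variables (R : realType) (d : measure_display) (T : measurableType d).
Variables (nu eta : probability T R).

(** A density of [nu], with its zeros replaced by [1]: being positive everywhere it
    can be divided by without almost-everywhere considerations, and the change of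
    density becomes an inequality. *)
Lemma finite_relative_entropy_density :
  (relative_entropy nu eta < +oo)%E -> exists r : T -> R,
  [/\ measurable_fun [set: T] r, forall x, 0 < r x,
      relative_entropy nu eta = (\int[nu]_x (ln (r x))%:E)%E &
      forall h : T -> R, measurable_fun [set: T] h -> (forall x, 0 <= h x) ->
        (\int[nu]_x (h x)%:E <= \int[eta]_x (h x * r x)%:E)%E].
Proof.
move=> Rfin.
have dom : nu `<< eta.
  by move: Rfin; rewrite /relative_entropy; case: asboolP => //; rewrite ltxx.
pose f := Radon_Nikodym_SigmaFinite.f nu eta.
have f_fin x : f x \is a fin_num by exact: Radon_Nikodym_SigmaFinite.f_fin_num.
have mf : measurable_fun [set: T] f.
  exact: measurable_int (Radon_Nikodym_SigmaFinite.f_integrable dom).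
pose w x := fine (f x).
have mw : measurable_fun [set: T] w by exact: measurableT_comp.
have w0 x : 0 <= w x.
  by apply: fine_ge0; exact: Radon_Nikodym_SigmaFinite.f_ge0.
have nuE A : measurable A -> nu A = (\int[eta]_(x in A) (w x)%:E)%E.
  move=> mA; rewrite [LHS](Radon_Nikodym_SigmaFinite.f_integral dom mA).
  by apply: eq_integral => x _; rewrite /w fineK.
pose r x := if w x <= 0 then 1 else w x.
have r0 x : 0 < r x.
  by rewrite /r; case: (leP (w x) 0) => // _; exact: ltr01.
have mr : measurable_fun [set: T] r.
  by apply: measurable_fun_ifT => //; exact: measurable_fun_ler.
exists r; split => //.
  rewrite (relative_entropy_density mw w0 nuE); apply: eq_integral => x _.
  rewrite /r; case: ifPn => // wx; rewrite ln1 ln0//.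
move=> h mh h0.
have h0' x : (0 <= (h x)%:E)%E by rewrite lee_fin.
rewrite (ge0_integral_density mw w0 nuE (measurable_EFin mh) h0').
apply: ge0_le_integral => //.
- by move=> x _; rewrite -EFinM lee_fin mulr_ge0.
- by apply: measurable_EFin; exact: measurable_funM.
- by apply: measurable_EFin; exact: measurable_funM.
- move=> x _; rewrite -EFinM lee_fin ler_wpM2l// /r.
  by case: (leP (w x) 0) => // wx; exact: le_trans wx ler01.
Qed.

(** The inequality [u <= expR u - 1] at [u = psi x - ln Z - ln (r x)], where [r]
    bounds the density and [Z] normalises [expR psi]; integrated against [nu],
    the right hand side is at most [0]. *)
Lemma entropy_young (r psi : T -> R) (Z : R) :
  measurable_fun [set: T] r -> (forall x, 0 < r x) ->
  (forall h : T -> R, measurable_fun [set: T] h -> (forall x, 0 <= h x) ->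
     (\int[nu]_x (h x)%:E <= \int[eta]_x (h x * r x)%:E)%E) ->
  measurable_fun [set: T] psi ->
  0 < Z -> (\int[eta]_x (expR (psi x))%:E = Z%:E)%E ->
  exists q : T -> R, [/\ forall x, 0 <= q x,
    nu.-integrable setT (EFin \o q), \int[nu]_x q x <= 1 &
    forall x, psi x - ln Z - ln (r x) <= q x - 1].
Proof.
move=> mr r0 rE mpsi Z0 ZE.
pose q x := expR (psi x - ln Z - ln (r x)).
have mq : measurable_fun [set: T] q.
  apply: measurableT_comp => //; apply: measurable_funB.
    exact: measurable_funB.
  exact: measurableT_comp.
have qE x : q x * r x = Z^-1 * expR (psi x).
  rewrite /q -[X in _ * X](lnK (r0 x : r x \is Num.pos)) -expRD subrK expRD expRN.
  by rewrite lnK// mulrC.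
have Iq : (\int[nu]_x (q x)%:E <= 1)%E.
  apply: (le_trans (rE q mq (fun x => expR_ge0 _))).
  under eq_integral do rewrite qE EFinM.
  have mexp : measurable_fun [set: T] (fun x => (expR (psi x))%:E).
    by apply: measurable_EFin; exact: measurableT_comp.
  have exp0 x : [set: T] x -> (0 <= (expR (psi x))%:E)%E.
    by rewrite lee_fin expR_ge0.
  have Zi0 : (0 <= Z^-1%:E)%E by rewrite lee_fin invr_ge0 ltW.
  rewrite (ge0_integralZl eta measurableT mexp exp0 Zi0) ZE -EFinM mulVf//.
  by rewrite gt_eqF.
have Iq' : nu.-integrable setT (EFin \o q).
  apply/integrableP; split; first exact: measurable_EFin.
  apply: (le_lt_trans _ (ltry 1)); apply: le_trans Iq.
  by under eq_integral do rewrite /= (ger0_norm (expR_ge0 _)).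
exists q; split => //.
- by move=> x; exact: expR_ge0.
- by rewrite -lee_fin -Rintegral_EFin.
- by move=> x; have := expR_ge1Dx (psi x - ln Z - ln (r x)); rewrite -/(q x); lra.
Qed.

(** The negative part of [ln r] is at most the function [q] given by
    [entropy_young] for [psi = 0]; finiteness of the entropy bounds the positive
    part. *)
Lemma integrable_ln_density (r : T -> R) :
  measurable_fun [set: T] r -> (forall x, 0 < r x) ->
  (forall h : T -> R, measurable_fun [set: T] h -> (forall x, 0 <= h x) ->
     (\int[nu]_x (h x)%:E <= \int[eta]_x (h x * r x)%:E)%E) ->
  (\int[nu]_x (ln (r x))%:E < +oo)%E ->
  nu.-integrable setT (EFin \o (fun x => ln (r x))).
Proof.
move=> mr r0 rE lfin.
have E1 : (\int[eta]_x (expR (cst 0 x))%:E = 1%:E)%E.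
  rewrite (Rintegral_EFin (f := fun x => expR (cst 0 x))).
    by rewrite /= expR0 Rintegral_prob_cst.
  exact: (integrable_EFin_cst eta (expR 0)).
have m0 : measurable_fun [set: T] (cst 0 : T -> R) by exact: measurable_cst.
have [q [q0 Iq q1 qE]] := entropy_young mr r0 rE m0 ltr01 E1.
have ml : measurable_fun [set: T] (fun x => (ln (r x))%:E).
  by apply: measurable_EFin; exact: measurableT_comp.
have neg_fin : (\int[nu]_x ((fun x => (ln (r x))%:E)^\- x) < +oo)%E.
  apply: (@le_lt_trans _ _ (\int[nu]_x (q x)%:E)%E); last first.
    by rewrite (Rintegral_EFin Iq) ltry.
  apply: ge0_le_integral => //.
  - exact: measurable_funeneg.
  - exact: measurable_int Iq.
  - move=> x _; rewrite funenegE /= -EFin_max lee_fin ge_max q0 andbT.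
    by have := qE x; rewrite /= ln1; lra.
apply/integrableP; split => //.
have -> : (\int[nu]_x `|(EFin \o (fun x => ln (r x))) x| =
  \int[nu]_x ((fun x => (ln (r x))%:E)^\+ x) +
  \int[nu]_x ((fun x => (ln (r x))%:E)^\- x))%E.
  rewrite -ge0_integralD//; [|exact: measurable_funepos|exact: measurable_funeneg].
  apply: eq_integral => x _.
  exact: (congr1 (fun g => g x) (fune_abse (fun x => (ln (r x))%:E))).
apply: lte_add_pinfty => //.
move: lfin; rewrite integralE.
case: (\int[nu]_x _^\+ x)%E => [s _||_]; [exact: ltry| |by []].
move: neg_fin; have : (0 <= \int[nu]_x ((fun x => (ln (r x))%:E)^\- x))%E.
  exact: integral_ge0.
by case: (\int[nu]_x _^\- x)%E.
Qed.

Variables (m : nat) (Y : T -> 'rV[R]_m).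
Hypothesis YE : has_exp_moments eta Y.

(** The Donsker-Varadhan lower bound. Applying [entropy_young] to plus and minus a
    coordinate of [Y] shows first that [Y] is [nu]-integrable, so that its mean is
    a genuine integral; applying it to [inner a (Y x)] then gives the bound. *)
Lemma relative_entropy_ge a : (relative_entropy nu eta < +oo)%E ->
  ((inner a (vec_integral nu Y) - log_mgf eta Y a)%:E
     <= relative_entropy nu eta)%E.
Proof.
move=> Rfin; have [r [mr r0 RE rE]] := finite_relative_entropy_density Rfin.
have Il : nu.-integrable setT (EFin \o (fun x => ln (r x))).
  by apply: integrable_ln_density => //; rewrite -RE.
have young b : exists q : T -> R, [/\ forall x, 0 <= q x,
    nu.-integrable setT (EFin \o q), \int[nu]_x q x <= 1 &
    forall x, inner b (Y x) - log_mgf eta Y b - ln (r x) <= q x - 1].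
  have Eb : (\int[eta]_x (expR (inner b (Y x)))%:E = (mgf eta Y b)%:E)%E.
    by apply: Rintegral_EFin; case: YE.
  exact: (entropy_young mr r0 rE (measurable_inner YE b) (mgf_gt0 YE b) Eb).
have IY j : nu.-integrable setT (EFin \o (fun x => Y x 0 j)).
  have [q [q0 Iq q1 qE]] := young (delta_mx 0 j).
  have [q' [q'0 Iq' q'1 q'E]] := young (- delta_mx 0 j).
  pose L b := log_mgf eta Y b.
  pose c := `|L (delta_mx 0 j)| + `|L (- delta_mx 0 j)|.
  have Iabs : nu.-integrable setT (EFin \o (fun x => `|ln (r x)|)).
    exact: (integrable_abse Il).
  have := integrable_EFinD (integrable_EFinD Iabs (integrable_EFin_cst nu c))
    (integrable_EFinD Iq Iq').
  apply: le_integrable_EFin; first by case: YE.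
  move=> x; apply: (norm_le_of_two_sided _ _ (q0 x) (q'0 x)).
    by have := qE x; rewrite inner_delta.
  by have := q'E x; rewrite innerNl inner_delta.
have [Ia innerE] := Rintegral_inner a IY.
have [q [q0 Iq q1 qE]] := young a.
rewrite RE (Rintegral_EFin Il) lee_fin -innerE.
have : \int[nu]_x (inner a (Y x) - log_mgf eta Y a - ln (r x)) <=
    \int[nu]_x (q x - 1).
  apply: le_Rintegral => //.
  - apply: integrable_EFinB => //; apply: integrable_EFinB => //.
    exact: integrable_EFin_cst.
  - by apply: integrable_EFinB => //; exact: integrable_EFin_cst.
rewrite RintegralB//; last first.
  by apply: integrable_EFinB => //; exact: integrable_EFin_cst.
rewrite RintegralB//; last exact: integrable_EFin_cst.
rewrite RintegralB//; last exact: integrable_EFin_cst.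
rewrite !Rintegral_prob_cst; lra.
Qed.

Lemma relative_entropy_ge0 : (0 <= relative_entropy nu eta)%E.
Proof.
have [/(relative_entropy_ge 0)|] := ltP (relative_entropy nu eta) +oo%E.
  by rewrite inner0l log_mgf0// subrr.
exact: le_trans.
Qed.

End donsker_varadhan.

(** * The variational formula at a fixed parameter *)

Lemma continuous_rV_box (R : realType) (m : nat) (f : 'rV[R]_m -> R)
    (b : 'rV[R]_m) (e : R) : continuous f -> 0 < e ->
  exists2 r : R, 0 < r &
    forall y : 'rV[R]_m, (forall j, `|y 0 j - b 0 j| < r) -> `|f y - f b| < e.
Proof.
move=> cf e0; have /cvgrPdist_lt /(_ e e0) := cf b.
move=> /nbhs_ballP [r /= r0 br]; exists r => // y yb; rewrite distrC; apply: br.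
by split => // i j; rewrite ord1 /ball /= distrC.
Qed.

Section entropic_inf.
Variables (R : realType) (d : measure_display) (T : measurableType d).
Variables (m : nat) (eta : probability T R) (Y : T -> 'rV[R]_m).
Variables (phi : 'rV[R]_m -> R) (B : R).
Hypothesis YE : has_exp_moments eta Y.
Hypothesis phiB : forall y, `|phi y| <= B.
Hypothesis cphi : continuous phi.

Local Notation Lam := (log_mgf eta Y).
Local Notation mean := (tilted_mean eta Y).

(** The value of [g] at a parameter [t], for [Y x = G x t]. *)
Definition entropic_inf : \bar R := ereal_inf (range (fun nu : probability T R =>
  ((phi (vec_integral nu Y))%:E + relative_entropy nu eta)%E)).

Lemma entropic_inf_le_tilt a :
  (entropic_inf <= (phi (mean a) + (inner a (mean a) - Lam a))%:E)%E.
Proof.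
have [nu [<- E]] := exponential_tilt YE a.
by apply: ereal_inf_lbound; exists nu => //; rewrite E.
Qed.

Lemma entropic_inf_ge : ((- B)%:E <= entropic_inf)%E.
Proof.
apply/ereal_infP => _ [nu _ <-].
have := relative_entropy_ge0 nu YE; case: (relative_entropy nu eta) => [s| |]//.
- by rewrite !lee_fin; have := phiB (vec_integral nu Y); rewrite ler_norml; lra.
- by move=> _; rewrite addey// leey.
Qed.

Lemma entropic_inf_fin_num : entropic_inf \is a fin_num.
Proof.
move: (entropic_inf_le_tilt 0) entropic_inf_ge.
by case: entropic_inf => [s| |].
Qed.

Lemma entropic_inf_fine_le_tilt a :
  fine entropic_inf <= phi (mean a) + (inner a (mean a) - Lam a).
Proof. by rewrite -lee_fin fineK ?entropic_inf_le_tilt// entropic_inf_fin_num. Qed.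

Lemma entropic_inf_fine_le : fine entropic_inf <= B.
Proof.
have := entropic_inf_fine_le_tilt 0; rewrite inner0l log_mgf0// subrr addr0.
by have := phiB (mean 0); rewrite ler_norml; lra.
Qed.

(** The tilt given by the regularised minimiser costs no more than
    [inner a b - log_mgf a] while its mean is close to [b], as soon as this cost
    is bounded by a constant known in advance. *)
Lemma tilt_near (b : 'rV[R]_m) (r S : R) : 0 < r -> 0 <= S -> exists a,
  inner a (mean a) - Lam a <= inner a b - Lam a /\
  (inner a b - Lam a <= S -> forall j, `|mean a 0 j - b 0 j| < r).
Proof.
move=> r0 S0; pose delta := r ^+ 2 / (2 * S + 1).
have S1 : 0 < 2 * S + 1 by lra.
have delta0 : 0 < delta by rewrite divr_gt0// exprn_gt0.
have [a [meanE aS]] := regularized_minimiser YE b delta0.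
have aa0 : 0 <= inner a a by apply: sumr_ge0 => j _; exact: sqr_ge0.
exists a; split.
  rewrite meanE -scaleNr innerDr innerZr.
  by have := mulr_ge0 (ltW delta0) aa0; lra.
move=> JS j; have -> : mean a 0 j - b 0 j = - (delta * a 0 j).
  by rewrite meanE !mxE addrAC subrr add0r.
rewrite normrN.
have aj : a 0 j ^+ 2 <= inner a a.
  by rewrite /inner (bigD1 j)//= lerDl sumr_ge0// => i _; exact: sqr_ge0.
(* delta ^+ 2 * inner a a <= delta * (2 * S), by the second claim on a *)
have : `|delta * a 0 j| ^+ 2 < r ^+ 2.
  rewrite real_normK ?num_real// exprMn.
  apply: (@le_lt_trans _ _ (delta * (2 * S))).
    rewrite expr2 -mulrA ler_pM2l//; apply: (@le_trans _ _ (delta * inner a a)).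
      by rewrite ler_wpM2l// ltW.
    by lra.
  rewrite /delta mulrAC ltr_pdivrMr// ltr_pM2l ?exprn_gt0//; lra.
by rewrite ltr_pXn2r// ?nnegrE// ltW.
Qed.

(** If [inner a b - log_mgf a] is large for the [a] of [tilt_near], the boundedness
    of [phi] suffices; otherwise the tilt by [a] is a competitor with mean near
    [b]. *)
Lemma entropic_inf_le_conjugate b e : 0 < e ->
  exists a, fine entropic_inf - e <= phi b + (inner a b - Lam a).
Proof.
move=> e0; have [r r0 phir] := continuous_rV_box b cphi e0.
have B0 : 0 <= B by apply: le_trans (phiB 0).
have B20 : 0 <= 2 * B by rewrite mulr_ge0.
have [a [ab near_b]] := tilt_near b r0 B20.
exists a; have [JB|JB] := leP (inner a b - Lam a) (2 * B).
  have := entropic_inf_fine_le_tilt a.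
  have := phir _ (near_b JB); rewrite ltr_norml; lra.
by have := entropic_inf_fine_le; have := phiB b; rewrite ler_norml; lra.
Qed.

(** Apply [tilt_near] at the mean [b] of a nearly optimal [nu]: by the
    Donsker-Varadhan bound the tilt has no larger entropy. *)
Lemma tilt_le_entropic_inf e : 0 < e -> exists a,
  phi (mean a) + (inner a (mean a) - Lam a) <= fine entropic_inf + e.
Proof.
move=> e0; have e20 : 0 < e / 2 by rewrite divr_gt0.
have [_ [nu _ <-]] := lb_ereal_inf_adherent e20 entropic_inf_fin_num.
rewrite -/entropic_inf; set b := vec_integral nu Y.
have := relative_entropy_ge0 nu YE.
have := relative_entropy_ge (nu := nu) YE.
case: (relative_entropy nu eta) => [s dv|_ _|_]//; last first.
  by rewrite addey// => /lt_geF; rewrite leey.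
rewrite lee_fin => s0.
rewrite -[X in (_ < X + _)%E](fineK entropic_inf_fin_num) -!EFinD lte_fin => phis.
have [r r0 phir] := continuous_rV_box b cphi e20.
have [a [ab near_b]] := tilt_near b r0 s0.
exists a; have Js : inner a b - Lam a <= s by rewrite -lee_fin dv// ltry.
by have := phir _ (near_b Js); rewrite ltr_norml; lra.
Qed.

End entropic_inf.

(** * Exponential bounds for a fixed sample size *)

Section free_energy_bounds.
Variables (R : realType) (d : measure_display) (Omega : measurableType d).
Variables (P : probability Omega R) (m : nat) (S : Omega -> 'rV[R]_m).
Variables (phi : 'rV[R]_m -> R) (B : R) (n : nat) (Lam : 'rV[R]_m -> R).
Hypothesis mS : forall j, measurable_fun [set: Omega] (fun w => S w 0 j).
Hypothesis cphi : continuous phi.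
Hypothesis phiB : forall y, `|phi y| <= B.
Hypothesis n0 : (0 < n)%N.
Hypothesis LamE : forall a,
  (\int[P]_w (expR (n%:R * inner a (S w)))%:E = (expR (n%:R * Lam a))%:E)%E.

Let Z := \int[P]_w expR (- (n%:R * phi (S w))).

Let nR0 : 0 < n%:R :> R.
Proof. by rewrite ltr0n. Qed.

Lemma integrable_expR_phi :
  P.-integrable setT (EFin \o (fun w => expR (- (n%:R * phi (S w))))).
Proof.
apply: (le_integrable_EFin _ _ (integrable_EFin_cst P (expR (n%:R * B)))).
  apply: measurableT_comp => //; apply: measurableT_comp => //.
  apply: measurable_funM => //; exact: measurable_continuous_rV.
move=> w; rewrite ger0_norm ?expR_ge0// ler_expR -mulrN ler_pM2l//.
by have := phiB (S w); rewrite ler_norml; lra.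
Qed.

Lemma integrable_expR_inner a :
  P.-integrable setT (EFin \o (fun w => expR (n%:R * inner a (S w)))).
Proof.
apply/integrableP; split.
  apply: measurable_EFin; apply: measurableT_comp => //.
  apply: measurable_funM => //; rewrite /inner; apply: measurable_sum => j.
  exact: measurable_funM.
under eq_integral do rewrite /= (ger0_norm (expR_ge0 _)).
by rewrite LamE ltry.
Qed.

Lemma Rintegral_expR_inner a :
  \int[P]_w expR (n%:R * inner a (S w)) = expR (n%:R * Lam a).
Proof. by rewrite /Rintegral LamE. Qed.

(** The hypothesis on [s] says that [expR (- n * phi y)] is at most the sum over
    [a] in [s] of [expR (n * (inner a y - L a - c))]; the expectations of these
    terms at [y = S] are known. *)
Lemma free_energy_ge (s : seq 'rV[R]_m) (L : 'rV[R]_m -> R) (c e : R) :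
  (forall y, exists2 a, a \in s & c <= phi y + (inner a y - L a)) ->
  (forall a, a \in s -> Lam a <= L a + e) ->
  Z <= (size s)%:R * expR (- (n%:R * (c - e))).
Proof.
move=> sP LL.
have Ia a : P.-integrable setT (EFin \o (fun w =>
    expR (- (n%:R * (L a + c))) * expR (n%:R * inner a (S w)))).
  by apply: integrable_EFinZ; exact: integrable_expR_inner.
apply: (@le_trans _ _ (\int[P]_w (\sum_(a <- s)
    expR (- (n%:R * (L a + c))) * expR (n%:R * inner a (S w))))).
  apply: le_Rintegral => //.
  - exact: integrable_expR_phi.
  - exact: integrable_EFin_sum.
  - move=> w _; have [a sa ca] := sP (S w).
    rewrite (big_rem a)//= -[leLHS]addr0 lerD//; last first.
      by apply: sumr_ge0 => i _; rewrite mulr_ge0 ?expR_ge0.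
    rewrite -expRD ler_expR -mulrN -mulrN -mulrDr ler_pM2l//; lra.
rewrite Rintegral_sum// mulr_natl -sum1_size -sumrMnr.
rewrite [leLHS]big_seq [leRHS]big_seq; apply: ler_sum => a sa.
rewrite RintegralZl//; last exact: integrable_expR_inner.
rewrite Rintegral_expR_inner mulr1n -expRD ler_expR -!mulrN -mulrDr ler_pM2l//.
by have := LL a sa; lra.
Qed.

(** Chernoff's bound: under the tilt by [a], each coordinate deviates from [b] by
    [r] with probability at most [expR (- n * q)] on either side. Written without
    the tilted law, this is a pointwise bound of [expR (n * inner a y)] by a
    constant times [expR (- n * phi y)], which covers the [y] near [b], plus the
    exponentials [Ap] and [Am] of linear functions of [y], one of which takes over
    when some coordinate of [y] is far from that of [b]. *)
Lemma free_energy_le (a b : 'rV[R]_m) (r t e q : R) :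
  0 <= t ->
  (forall y : 'rV[R]_m, (forall j, `|y 0 j - b 0 j| < r) ->
     phi y + inner a y <= phi b + inner a b + e) ->
  (forall j, Lam (a + t *: delta_mx 0 j) - t * (b 0 j + r) <= Lam a - q) ->
  (forall j, Lam (a - t *: delta_mx 0 j) - t * (r - b 0 j) <= Lam a - q) ->
  (2 * m)%:R * expR (- (n%:R * q)) <= 2^-1 ->
  2^-1 * expR (- (n%:R * (phi b + inner a b - Lam a + e))) <= Z.
Proof.
move=> t0 near_b Lp Lm mq.
pose C := expR (n%:R * (phi b + inner a b + e)).
pose Ap j w := expR (- (n%:R * (t * (b 0 j + r)))) *
  expR (n%:R * inner (a + t *: delta_mx 0 j) (S w)).
pose Am j w := expR (- (n%:R * (t * (r - b 0 j)))) *
  expR (n%:R * inner (a - t *: delta_mx 0 j) (S w)).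
have IAp j : P.-integrable setT (EFin \o Ap j).
  by apply: integrable_EFinZ; exact: integrable_expR_inner.
have IAm j : P.-integrable setT (EFin \o Am j).
  by apply: integrable_EFinZ; exact: integrable_expR_inner.
have IA j : P.-integrable setT (EFin \o (fun w => Ap j w + Am j w)).
  exact: integrable_EFinD.
have IC := integrable_EFinZ C integrable_expR_phi.
have Iall := integrable_EFinD IC (integrable_EFin_sum (index_enum 'I_m) IA).
have A0 j w : 0 <= Ap j w + Am j w.
  by rewrite addr_ge0// mulr_ge0 ?expR_ge0.
have pointwise w : expR (n%:R * inner a (S w)) <=
    C * expR (- (n%:R * phi (S w))) + \sum_j (Ap j w + Am j w).
  have sum0 : 0 <= \sum_j (Ap j w + Am j w) by apply: sumr_ge0 => j _.
  have [yb|/existsNP [j /negP]] := pselect (forall j, `|S w 0 j - b 0 j| < r).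
    rewrite -[leLHS]addr0 lerD// /C -expRD ler_expR -mulrN -mulrDr ler_pM2l//.
    by have := near_b _ yb; lra.
  rewrite -leNgt => jr.
  rewrite -[leLHS]add0r lerD//; first by rewrite mulr_ge0 ?expR_ge0.
  rewrite (bigD1 j)//= -[leLHS]addr0 lerD//; last by apply: sumr_ge0.
  have := ler_norm (S w 0 j - b 0 j).
  have [s0|s0] := leP 0 (S w 0 j - b 0 j); move: jr.
    rewrite ger0_norm// => jr _.
    rewrite -[leLHS]addr0 lerD//; last by rewrite mulr_ge0 ?expR_ge0.
    rewrite /Ap -expRD ler_expR -mulrN -mulrDr ler_pM2l//.
    rewrite innerDl innerZl inner_delta.
    have := mulr_ge0 t0 (_ : 0 <= S w 0 j - b 0 j - r); rewrite subr_ge0 => /(_ jr).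
    lra.
  rewrite ltr0_norm// => jr _.
  rewrite -[leLHS]add0r lerD//; first by rewrite mulr_ge0 ?expR_ge0.
  rewrite /Am -expRD ler_expR -mulrN -mulrDr ler_pM2l//.
  rewrite innerDl innerNl innerZl inner_delta.
  have := mulr_ge0 t0 (_ : 0 <= - (S w 0 j - b 0 j) - r); rewrite subr_ge0 => /(_ jr).
  lra.
have : \int[P]_w expR (n%:R * inner a (S w)) <=
    \int[P]_w (C * expR (- (n%:R * phi (S w))) + \sum_j (Ap j w + Am j w)).
  by apply: le_Rintegral => //; exact: integrable_expR_inner.
rewrite Rintegral_expR_inner RintegralD//; last exact: integrable_EFin_sum.
rewrite RintegralZl//; last exact: integrable_expR_phi.
rewrite -/Z Rintegral_sum// => le1.
have le2 : \sum_j \int[P]_w (Ap j w + Am j w) <=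
    (2 * m)%:R * expR (- (n%:R * q)) * expR (n%:R * Lam a).
  have -> : (2 * m)%:R * expR (- (n%:R * q)) * expR (n%:R * Lam a) =
      \sum_(j < m) (2 * expR (n%:R * (Lam a - q))).
    rewrite sumr_const card_ord -[RHS]mulr_natl natrM -!mulrA -expRD.
    by rewrite mulrBr [X in expR X]addrC mulrCA.
  apply: ler_sum => j _; rewrite RintegralD// !RintegralZl//;
    try exact: integrable_expR_inner.
  rewrite !Rintegral_expR_inner -!expRD -!mulrN -!mulrDr.
  have -> : 2 * expR (n%:R * (Lam a - q)) =
    expR (n%:R * (Lam a - q)) + expR (n%:R * (Lam a - q)) by ring.
  apply: lerD; rewrite ler_expR ler_pM2l//.
    by have := Lp j; lra.
  by have := Lm j; lra.
have le3 : 2^-1 * expR (n%:R * Lam a) <= C * Z.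
  have := ler_wpM2r (expR_ge0 (n%:R * Lam a)) mq; lra.
have -> : - (n%:R * (phi b + inner a b - Lam a + e)) =
  n%:R * Lam a - n%:R * (phi b + inner a b + e) by ring.
by rewrite expRD expRN mulrA ler_pdivrMr ?expR_gt0// [leRHS]mulrC.
Qed.

Lemma free_energy_gt0 : 0 < Z.
Proof.
have : \int[P]_w expR (- (n%:R * B)) <= Z.
  apply: le_Rintegral => //; first exact: integrable_EFin_cst.
    exact: integrable_expR_phi.
  move=> w _; rewrite ler_expR lerN2 ler_pM2l//.
  by have := phiB (S w); rewrite ler_norml; lra.
by rewrite Rintegral_prob_cst; apply: lt_le_trans; exact: expR_gt0.
Qed.

End free_energy_bounds.

(** * Finite covers, empirical means and continuous families *)

(** Outside a large box a multiple of a coordinate functional does the job,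
    because [phi] is bounded; the box itself is compact. *)
Lemma finite_conjugate_cover (R : realType) (m : nat) (phi L : 'rV[R]_m -> R)
    (B c : R) : continuous phi -> (forall y, `|phi y| <= B) ->
  (forall b, exists a, c < phi b + (inner a b - L a)) ->
  exists s : seq 'rV[R]_m,
    forall y, exists2 a, a \in s & c <= phi y + (inner a y - L a).
Proof.
move=> cphi phiB ex_a.
pose l j := `|L (delta_mx 0 j)| + `|L (- delta_mx 0 j)|.
have l0 j : 0 <= l j by rewrite addr_ge0.
pose A := `|c| + B + \sum_(j < m) l j.
pose box := [set v : 'rV[R]_m | forall j, `[- A, A]%classic (v ord0 j)].
have cbox : compact box.
  by apply: (@rV_compact R m (fun=> `[- A, A]%classic)) => j; exact: segment_compact.
pose U (a : 'rV[R]_m) := [set y | c < phi y + (inner a y - L a)].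
have oU a : setT a -> open (U a).
  move=> _; have cf : continuous (fun y => phi y + (inner a y - L a)).
    move=> y; have Fy : Filter (nbhs y) by exact: nbhs_filter.
    have c2 : inner a x @[x --> y] --> inner a y.
      exact: (cvg_inner Fy (@cvg_cst _ a _ (nbhs y) Fy) (@cvg_id _ (nbhs y))).
    exact: (cvgD (cphi y) (cvgB c2 (cvg_cst (L a)))).
  have -> : U a = (fun y => phi y + (inner a y - L a)) @^-1` [set x | c < x] by [].
  by move/continuousP : cf; apply; exact: open_gt.
have [D' _ boxD] : finite_subset_cover setT U box.
  move: cbox; rewrite compact_cover; apply => //.
  by move=> y _; have [a ya] := ex_a y; exists a.
exists (enum_fset D' ++ ([seq delta_mx 0 j | j <- index_enum 'I_m] ++
                         [seq - delta_mx 0 j | j <- index_enum 'I_m])) => y.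
have [/boxD [a /= aD ya]|/existsNP [j yj]] := pselect (box y).
  by exists a; [rewrite mem_cat aD|exact: ltW].
have {yj} yj : A < `|y 0 j|.
  by rewrite ltNge; apply/negP => yA; apply: yj; rewrite /= in_itv/= -ler_norml.
have lA : `|c| + B + l j <= A.
  by rewrite /A lerD2l (bigD1 j)//= lerDl sumr_ge0.
have := phiB y; rewrite ler_norml => /andP[phiy _].
have := ler_norm c; have := ler_norm (L (delta_mx 0 j)).
have := ler_norm (L (- delta_mx 0 j)).
have := normr_ge0 (L (delta_mx 0 j)); have := normr_ge0 (L (- delta_mx 0 j)).
rewrite /l in lA.
have [y0|y0] := leP 0 (y 0 j).
  move: yj; rewrite ger0_norm// => yj *.
  exists (delta_mx 0 j); last by rewrite inner_delta; lra.
  by rewrite !mem_cat map_f ?orbT// mem_index_enum.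
move: yj; rewrite ltr0_norm// => yj *.
exists (- delta_mx 0 j); last by rewrite innerNl inner_delta; lra.
by rewrite !mem_cat (map_f (fun j => - delta_mx 0 j)) ?orbT// mem_index_enum.
Qed.

Lemma near_forall_seq (T : Type) (J : eqType) (F : set_system T)
    (s : seq J) (Q : J -> T -> Prop) : Filter F ->
  (forall a, \forall x \near F, Q a x) ->
  \forall x \near F, forall a, a \in s -> Q a x.
Proof.
move=> FF Qn; elim: s => [|b s IH]; first by near=> x.
apply: filterS2 IH (Qn b) => x xs xb a; rewrite inE => /orP[/eqP->//|].
exact: xs.
Unshelve. all: by end_near. Qed.

(** The expectation of a product of independent factors; the normalisation by [n]
    cancels. *)
Lemma integral_expR_empirical_mean (R : realType) (d d' : measure_display)
    (Omega : measurableType d) (T : measurableType d') (P : probability Omega R)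
    (X : nat -> {RV P >-> T}) (eta : probability T R) (m : nat)
    (Y : T -> 'rV[R]_m) (n : nat) (a : 'rV[R]_m) :
  iid X eta -> has_exp_moments eta Y -> (0 < n)%N ->
  (\int[P]_w (expR (n%:R * inner a (n%:R^-1 *: \sum_(i < n) Y (X i w))))%:E =
   (expR (n%:R * log_mgf eta Y a))%:E)%E.
Proof.
move=> XX YE n0; have nR0 : n%:R != 0 :> R by rewrite pnatr_eq0 -lt0n.
rewrite expRM_natl expR_log_mgf//.
have E : (\int[eta]_x (expR (inner a (Y x)))%:E = (mgf eta Y a)%:E)%E.
  by apply: Rintegral_EFin; case: YE.
rewrite -(expectation_prod_iid n XX (measurable_expR_inner YE a)
  (fun x => expR_ge0 _) E).
apply: eq_integral => w _; congr EFin.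
rewrite innerZr mulrA mulfV// mul1r innerC inner_suml expR_sum.
by apply: eq_bigr => i _; rewrite innerC.
Qed.

Lemma integral_iid (R : realType) (d d' : measure_display)
    (Omega : measurableType d) (T : measurableType d') (P : probability Omega R)
    (X : nat -> {RV P >-> T}) (eta : probability T R) (i : nat)
    (f : T -> \bar R) :
  iid X eta -> measurable_fun [set: T] f -> (forall x, (0 <= f x)%E) ->
  (\int[P]_w f (X i w) = \int[eta]_x f x)%E.
Proof.
move=> [_ distr] mf f0.
rewrite -[LHS](ge0_integral_distribution (X i) mf f0).
by apply: eq_measure_integral => A mA _; exact: (distr i A mA).
Qed.

Section continuous_family.
Variables (R : realType) (h d m : nat) (Theta : set 'rV[R]_d).
Variable G : 'rV[R]_h -> 'rV[R]_d -> 'rV[R]_m.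
Hypothesis cG : {within [set: 'rV[R]_h] `*` Theta,
    continuous (fun z : 'rV[R]_h * 'rV[R]_d => G z.1 z.2)}.

Lemma cvg_family (J : Type) (F : set_system J) (x_ : J -> 'rV[R]_h)
    (u : J -> 'rV[R]_d) x t : Filter F -> (forall i, Theta (u i)) -> Theta t ->
  x_ @ F --> x -> u @ F --> t -> G (x_ i) (u i) @[i --> F] --> G x t.
Proof.
move=> FF uT tT xx ut; move/subspace_continuousP : cG => /(_ (x, t)).
move=> /(_ (conj I tT)) Gc.
have xu : (x_ i, u i) @[i --> F] -->
    within ([set: 'rV[R]_h] `*` Theta) (nbhs (x, t)).
  move=> /= V; rewrite /within /= => xtV.
  have : F (fun i => ([set: 'rV[R]_h] `*` Theta) (x_ i, u i) -> V (x_ i, u i)).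
    exact: (cvg_pair xx ut xtV).
  apply: (@filterS _ F FF) => i; apply; split => //; exact: uT.
exact: (cvg_comp _ _ xu Gc).
Qed.

Lemma continuous_family t : Theta t -> continuous (fun x => G x t).
Proof.
move=> tT x; have Fx : Filter (nbhs x) by exact: nbhs_filter.
exact: (cvg_family Fx (fun=> tT) tT (@cvg_id _ (nbhs x)) (@cvg_cst _ t _ (nbhs x) Fx)).
Qed.

Lemma measurable_coord_family t j : Theta t ->
  measurable_fun [set: borel_rV R h] (fun x : borel_rV R h => G x t 0 j).
Proof.
move=> tT; apply: (measurability _ (RGenOpens.measurableE R)).
move=> _ [_ [a [b ->] <-]]; rewrite setTI.
apply: sub_sigma_algebra.
have /continuousP : continuous (fun x : 'rV[R]_h => G x t 0 j).
  move=> x.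
  exact: (cvg_comp _ _ (@continuous_family t tT x) (@coord_continuous _ _ _ 0 j (G x t))).
by apply; exact: interval_open.
Qed.

End continuous_family.

(** * Uniform convergence *)

(** The decay rate [t * r / 4] in Chernoff's bound: of the gain [t * r], half pays
    for the quadratic error [k], and a quarter for moving [x] and [y] from the
    reference parameter to a nearby one. *)
Lemma exponent_gap (R : realType) (x x0 y y0 k t b r : R) :
  `|x - x0| < t * r / 4 / 2 -> `|y - y0| < t * r / 4 / 2 ->
  x0 <= y0 + t * b + k -> k <= t * r / 2 ->
  x - t * (b + r) <= y - t * r / 4.
Proof. by rewrite !ltr_norml => /andP[? ?] /andP[? ?]; lra. Qed.

Lemma le_scaled_gap (R : realType) (n l p i x x0 v e : R) : 0 < n ->
  l <= n * (e / 4) -> `|x - x0| < e / 4 -> p + (i - x0) <= v + e / 4 ->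
  n * - (v + e) <= - l - n * (p + i - x + e / 4).
Proof.
move=> n0 ln; rewrite ltr_norml => /andP[x1 x2] pv.
have : n * (p + i - x + e / 4) <= n * (v + e - e / 4) by rewrite ler_pM2l//; lra.
by rewrite mulrN [n * (v + e - _)]mulrBr; lra.
Qed.

Lemma le_dist_common (R : realType) (x y z e : R) :
  `|z - x| <= e / 4 -> `|z - y| <= e / 4 -> `|y - x| <= e / 2.
Proof.
by rewrite !ler_norml => /andP[? ?] /andP[? ?]; apply/andP; split; lra.
Qed.

Lemma lt_dist_via (R : realType) (x y z e : R) : 0 < e ->
  `|y - x| <= e / 2 -> `|z - x| <= e / 4 -> `|z - y| < e.
Proof.
move=> e0; rewrite !ler_norml ltr_norml => /andP[? ?] /andP[? ?].
by apply/andP; split; lra.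
Qed.

Section laplace_principle.
Variables (R : realType) (h d m : nat) (dOmega : measure_display).
Variables (Omega : measurableType dOmega) (P : probability Omega R).
Variable eta : probability (borel_rV R h) R.
Variable X : nat -> {RV P >-> borel_rV R h}.
Variable Theta : set 'rV[R]_d.
Variable G : 'rV[R]_h -> 'rV[R]_d -> 'rV[R]_m.
Variable phi : 'rV[R]_m -> R.
Hypothesis XX : iid X eta.
Hypothesis cG : {within [set: 'rV[R]_h] `*` Theta,
    continuous (fun z : 'rV[R]_h * 'rV[R]_d => G z.1 z.2)}.
Hypothesis supH : forall alpha : 'rV[R]_m,
    (ereal_sup [set H2 (X 0%N) G theta alpha | theta in Theta] < +oo)%E.

Let Y (t : 'rV[R]_d) (x : borel_rV R h) : 'rV[R]_m := G x t.

(** The supremum bounds [lne] of the moment generating function, which also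
    excludes the value [+oo]. *)
Lemma mgf_family_bounded a : exists K : R, forall t, Theta t ->
  (\int[eta]_x (expR (inner a (Y t x)))%:E <= K%:E)%E.
Proof.
have [K HK] : exists K : R, forall t, Theta t -> (H2 (X 0%N) G t a <= K%:E)%E.
  have := supH a; set s := ereal_sup _ => sfin.
  have ub t : Theta t -> (H2 (X 0%N) G t a <= s)%E.
    by move=> tT; apply: ereal_sup_ubound; exists t.
  move: sfin ub; case: s => [s _ ub|//|_ ub]; first by exists s.
  by exists 0 => t /ub; rewrite leeNy_eq => /eqP ->; exact: leNye.
exists (expR K) => t tT; have := HK t tT; rewrite /H2 unlock.
have mf : measurable_fun [set: borel_rV R h] (fun x => (expR (inner a (Y t x)))%:E).
  apply: measurable_EFin; apply: measurableT_comp => //.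
  rewrite /inner; apply: measurable_sum => j; apply: measurable_funM => //.
  exact: (measurable_coord_family cG).
rewrite (integral_iid 0%N XX mf) => [|x]; last by rewrite lee_fin expR_ge0.
case: (\int[eta]_x _)%E => [s| |]//=.
  case: ifPn => [s0 _|]; first by rewrite lee_fin (le_trans s0)// expR_ge0.
  by rewrite -ltNge !lee_fin -ler_expR => s0; rewrite lnK// posrE.
by rewrite !leNye.
Qed.

Lemma family_has_exp_moments t : Theta t -> has_exp_moments eta (Y t).
Proof.
move=> tT; split=> [j|a]; first exact: (measurable_coord_family cG).
apply/integrableP; split.
  apply: measurable_EFin; apply: measurableT_comp => //.
  rewrite /inner; apply: measurable_sum => j; apply: measurable_funM => //.
  exact: (measurable_coord_family cG).
under eq_integral do rewrite /= (ger0_norm (expR_ge0 _)).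
have [K KP] := mgf_family_bounded a.
exact: le_lt_trans (KP t tT) (ltry K).
Qed.

Lemma near_log_mgf_family t0 a e : Theta t0 -> 0 < e ->
  \forall t \near t0, Theta t ->
    `|log_mgf eta (Y t) a - log_mgf eta (Y t0) a| < e.
Proof.
move=> tT e0; apply: near_within_of_seq => // u uT ut.
have [K KP] := mgf_family_bounded (2 *: a).
have MK t : Theta t -> mgf eta (Y t) (2 *: a) <= K.
  move=> tT'; rewrite -lee_fin /mgf -Rintegral_EFin; first exact: KP.
  by case: (family_has_exp_moments tT').
have cM : mgf eta (Y (u k)) a @[k --> \oo] --> mgf eta (Y t0) a.
  apply: (@cvg_mgf _ _ _ _ _ _ _ (fun=> a) a K) => //.
  - by move=> k; exact: family_has_exp_moments.
  - exact: family_has_exp_moments.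
  - by move=> k; exact: MK.
  - exact: MK.
  - exact: cvg_cst.
  - by move=> x; apply: (cvg_family cG _ uT tT) => //; exact: cvg_cst.
have M0 := mgf_gt0 (family_has_exp_moments tT) a.
exact: (continuous_cvg _ (continuous_ln M0) cM).
Qed.

Hypothesis cphi : continuous phi.
Variable B : R.
Hypothesis phiB : forall y, `|phi y| <= B.

Let Zn n t := \int[P]_w expR (- (n%:R * phi (n%:R^-1 *: \sum_(i < n) Y t (X i w)))).

Lemma gnE n t : gn X G phi n t = - (n%:R^-1 * ln (Zn n t)).
Proof. by rewrite /gn unlock. Qed.

Lemma gE t : g eta G phi t = entropic_inf eta (Y t) phi.
Proof. by []. Qed.

Let mS n t : Theta t -> forall j, measurable_fun [set: Omega]
  (fun w => (n%:R^-1 *: \sum_(i < n) Y t (X i w)) 0 j).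
Proof.
move=> tT j; rewrite (_ : (fun w => _) =
  (fun w => n%:R^-1 * \sum_(i < n) Y t (X i w) 0 j)).
  apply: measurable_funM => //; apply: measurable_sum => i.
  have mX : measurable_fun [set: Omega] (X i) by exact: measurable_funPT.
  exact: (measurableT_comp (measurable_coord_family cG j tT) mX).
by apply/funext => w; rewrite mxE summxE.
Qed.

(** Of the error [e], one half comes from the choice of the finite family, one
    quarter from moving [log_mgf] from [t0] to [t], and one quarter from the
    logarithm of the size of the family divided by [n]. *)
Lemma near_gn_ge t0 e : Theta t0 -> 0 < e ->
  \forall t \near t0 & n \near \oo, Theta t ->
    fine (g eta G phi t0) - e <= gn X G phi n t.
Proof.
move=> tT e0; rewrite gE; set v := fine _.
have YE := family_has_exp_moments tT.
have e40 : 0 < e / 4 by rewrite divr_gt0.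
have [b|s sP] := finite_conjugate_cover (L := log_mgf eta (Y t0))
    (c := v - e / 2) cphi phiB.
  have [a va] := entropic_inf_le_conjugate YE phiB cphi b e40.
  by exists a; move: va; rewrite -/v; lra.
have Ln : \forall t \near t0, forall a, a \in s -> Theta t ->
    `|log_mgf eta (Y t) a - log_mgf eta (Y t0) a| < e / 4.
  exact: (near_forall_seq s (nbhs_filter t0) (fun a => near_log_mgf_family a tT e40)).
have Nn : \forall n \near \oo, `|ln (size s)%:R| / (e / 4) < n%:R.
  exact: nbhs_infty_gtr.
exists ([set t | forall a, a \in s -> Theta t ->
    `|log_mgf eta (Y t) a - log_mgf eta (Y t0) a| < e / 4],
  [set n | `|ln (size s)%:R| / (e / 4) < n%:R]) => //.
move=> [t n] /= [Lt Nt] tT'.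
have nR0 : 0 < n%:R :> R by apply: le_lt_trans Nt; rewrite divr_ge0// ltW.
have n0 : (0 < n)%N by move: nR0; rewrite ltr0n.
have YE' := family_has_exp_moments tT'.
have := free_energy_ge (mS n tT') cphi phiB n0
  (fun a => integral_expR_empirical_mean a XX YE' n0) (e := e / 4) sP.
have Lae a : a \in s -> log_mgf eta (Y t) a <= log_mgf eta (Y t0) a + e / 4.
  by move=> sa; have := Lt a sa tT'; rewrite ltr_distl => /andP[_ /ltW].
move=> /(_ Lae); rewrite -/(Zn n t) => ZU.
have Z0 : 0 < Zn n t := free_energy_gt0 P (mS n tT') cphi phiB n0.
have s0 : 0 < (size s)%:R :> R.
  by have [a + _] := sP 0; rewrite ltr0n; case: (s).
rewrite gnE lerNr ler_pdivrMl//.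
have : ln (Zn n t) <= ln (size s)%:R - n%:R * (v - e / 2 - e / 4).
  by rewrite -ler_expR lnK// expRD lnK.
move/le_trans; apply.
move: Nt; rewrite ltr_pdivrMr// => Nt.
have := ler_norm (ln (size s)%:R : R).
rewrite mulrN mulrBr; lra.
Qed.

(** The four quarters of [e] pay for the suboptimality of the tilt, the oscillation
    of [phi y + inner a y] near its mean [b], the passage from [t0] to [t], and the
    factor [2^-1] in [free_energy_le]. *)
Lemma near_gn_le t0 e : Theta t0 -> 0 < e ->
  \forall t \near t0 & n \near \oo, Theta t ->
    gn X G phi n t <= fine (g eta G phi t0) + e.
Proof.
move=> tT e0; rewrite gE; set v := fine _.
have YE := family_has_exp_moments tT.
have e40 : 0 < e / 4 by rewrite divr_gt0.
have [a] := tilt_le_entropic_inf YE phiB cphi e40.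
rewrite -/v; set b := tilted_mean _ _ _ => va.
pose L t := log_mgf eta (Y t).
have cf : continuous (fun y : 'rV[R]_m => phi y + inner a y).
  move=> y; have Fy : Filter (nbhs y) by exact: nbhs_filter.
  have c2 : inner a x @[x --> y] --> inner a y.
    exact: (cvg_inner Fy (@cvg_cst _ a _ (nbhs y) Fy) (@cvg_id _ (nbhs y))).
  have c1 : phi x @[x --> y] --> phi y by exact: cphi.
  exact: (cvgD c1 c2).
have [r r0 near_b] := continuous_rV_box b cf e40.
have /choice [K KP] (j : 'I_m) : exists K, 0 <= K /\ forall t, `|t| <= 2^-1 ->
    L t0 (a + t *: delta_mx 0 j) <= L t0 a + t * b 0 j + K * t ^+ 2.
  by have [K K0 KP] := log_mgf_le_quadratic YE a j; exists K.
pose Kmax := \sum_(j < m) K j.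
have KK j : K j <= Kmax.
  rewrite /Kmax (bigD1 j)//= lerDl sumr_ge0// => i _; exact: (KP i).1.
have Kmax0 : 0 <= Kmax by apply: sumr_ge0 => j _; exact: (KP j).1.
have K1 : 0 < Kmax + 1 by lra.
(* small enough for the quadratic error K j * t ^+ 2 to be at most t * r / 2 *)
pose t := Num.min 2^-1 (r / 2 / (Kmax + 1)).
have t0' : 0 < t by rewrite /t lt_min invr_gt0 ltr0n/= !divr_gt0.
have t2 : `|t| <= 2^-1 by rewrite gtr0_norm// /t ge_min lexx.
have tr : (Kmax + 1) * t <= r / 2.
  by rewrite -ler_pdivlMl// [_^-1 * _]mulrC /t ge_min lexx orbT.
pose q := t * r / 4.
have tr0 : 0 < t * r by rewrite mulr_gt0.
have q0 : 0 < q by rewrite divr_gt0.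
have q20 : 0 < q / 2 by rewrite divr_gt0.
have Kt j : K j * t ^+ 2 <= t * r / 2.
  have : K j * t <= r / 2.
    by apply: le_trans tr; rewrite ler_pM2r//; have := KK j; lra.
  rewrite expr2; nra.
pose s := a :: ([seq a + t *: delta_mx 0 j | j <- index_enum 'I_m] ++
                [seq a - t *: delta_mx 0 j | j <- index_enum 'I_m]).
have dq0 : 0 < Num.min (q / 2) (e / 4) by rewrite lt_min q20.
have Ln : \forall t' \near t0, forall c, c \in s -> Theta t' ->
    `|L t' c - L t0 c| < Num.min (q / 2) (e / 4).
  exact: (near_forall_seq s (nbhs_filter t0) (fun c => near_log_mgf_family c tT dq0)).
(* the first term makes the Chernoff error at most 1/2, the second ln 2 / n at
   most e / 4 *)
pose N : R := (4 * m)%:R / q + ln 2 / (e / 4).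
have ln20 : 0 <= ln (2 : R) by rewrite ln_ge0// ler1n.
have N0 : 0 <= N by rewrite addr_ge0// divr_ge0// ltW.
have Nn : \forall n \near \oo, N < n%:R by exact: nbhs_infty_gtr.
exists ([set t' | forall c, c \in s -> Theta t' ->
    `|L t' c - L t0 c| < Num.min (q / 2) (e / 4)], [set n | N < n%:R]) => //.
move=> [t' n] /= [Lt Nt] tT'.
have nR0 : 0 < n%:R :> R by exact: le_lt_trans Nt.
have n0 : (0 < n)%N by move: nR0; rewrite ltr0n.
have YE' := family_has_exp_moments tT'.
have {}Lt c : c \in s -> `|L t' c - L t0 c| < q / 2 /\ `|L t' c - L t0 c| < e / 4.
  by move=> cs; have := Lt c cs tT'; rewrite lt_min => /andP[].
have [La1 La2] := Lt a (mem_head _ _).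
have near_b' : forall y : 'rV[R]_m, (forall j, `|y 0 j - b 0 j| < r) ->
    phi y + inner a y <= phi b + inner a b + e / 4.
  by move=> y /near_b; rewrite ltr_norml; lra.
have Lp j : L t' (a + t *: delta_mx 0 j) - t * (b 0 j + r) <= L t' a - q.
  have [|Lj _] := Lt (a + t *: delta_mx 0 j).
    rewrite inE mem_cat (map_f (fun j => a + t *: delta_mx 0 j)) ?orbT//.
    exact: mem_index_enum.
  exact: (exponent_gap Lj La1 ((KP j).2 t t2) (Kt j)).
have Lm j : L t' (a - t *: delta_mx 0 j) - t * (r - b 0 j) <= L t' a - q.
  have [|Lj _] := Lt (a - t *: delta_mx 0 j).
    rewrite inE mem_cat (map_f (fun j => a - t *: delta_mx 0 j)) ?orbT//.
    exact: mem_index_enum.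
  have t2' : `|- t| <= 2^-1 by rewrite normrN.
  have := (KP j).2 (- t) t2'; rewrite scaleNr sqrrN mulNr -mulrN => Kj.
  by rewrite [r - _]addrC; exact: (exponent_gap Lj La1 Kj (Kt j)).
have mq : (2 * m)%:R * expR (- (n%:R * q)) <= 2^-1.
  rewrite expRN ler_pdivrMr ?expR_gt0//.
  apply: (@le_trans _ _ (2^-1 * (n%:R * q))); last first.
    by rewrite ler_wpM2l//; have := expR_ge1Dx (n%:R * q); lra.
  have : (4 * m)%:R / q <= n%:R.
    apply: le_trans (ltW Nt); rewrite /N lerDl divr_ge0// ltW//.
  rewrite ler_pdivrMr// !natrM; lra.
have := free_energy_le (mS n tT') cphi phiB n0
  (fun a => integral_expR_empirical_mean a XX YE' n0) (ltW t0') near_b' Lp Lm mq.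
rewrite -/(Zn n t') => ZL.
have Z0 : 0 < Zn n t' := free_energy_gt0 P (mS n tT') cphi phiB n0.
rewrite gnE lerNl ler_pdivlMl//.
have : - ln 2 - n%:R * (phi b + inner a b - L t' a + e / 4) <= ln (Zn n t').
  by rewrite -ler_expR lnK// expRD expRN lnK// posrE.
apply: le_trans.
have ln2n : ln 2 <= n%:R * (e / 4).
  rewrite -ler_pdivrMr//; apply: le_trans (ltW Nt).
  by rewrite /N lerDr divr_ge0// ltW.
exact: le_scaled_gap nR0 ln2n La2 va.
Qed.

Lemma near_gn t0 e : Theta t0 -> 0 < e ->
  \forall t \near t0 & n \near \oo, Theta t ->
    `|gn X G phi n t - fine (g eta G phi t0)| <= e.
Proof.
move=> tT e0; apply: filterS2 (near_gn_ge tT e0) (near_gn_le tT e0).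
move=> [t n] /= h1 h2 tT'.
by rewrite ler_norml; apply/andP; split; [have := h1 tT'|have := h2 tT']; lra.
Qed.

(** Continuous convergence: letting [n] go to infinity in [near_gn] shows that
    the limit is continuous, so that [near_gn] also compares [gn] with the value
    of the limit at the same point. *)
Lemma near_gn_same t0 e : Theta t0 -> 0 < e ->
  \forall t \near t0 & n \near \oo, Theta t ->
    `|gn X G phi n t - fine (g eta G phi t)| < e.
Proof.
move=> tT e0; have e40 : 0 < e / 4 by rewrite divr_gt0.
have [[U V] /= [nU nV] UV] := near_gn tT e40.
exists (U, V) => // -[t n] /= [Ut Vn] tT'.
have le1 : `|fine (g eta G phi t) - fine (g eta G phi t0)| <= e / 2.
  have [[U' V'] /= [nU' nV'] UV'] := near_gn tT' e40.
  have [k [Vk V'k]] : (V `&` V') !=set0.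
    by apply: (@filter_ex _ \oo); exact: filterI.
  exact: (le_dist_common (UV (t, k) (conj Ut Vk) tT')
    (UV' (t, k) (conj (nbhs_singleton nU') V'k) tT')).
exact: (lt_dist_via e0 le1 (UV (t, n) (conj Ut Vn) tT')).
Qed.

End laplace_principle.

Unset Implicit Arguments.

Theorem theorem3p2 (R : realType) (h d m : nat)
    (dOmega : measure_display) (Omega : measurableType dOmega)
    (P : probability Omega R)
    (eta : probability (borel_rV R h) R)
    (X : nat -> {RV P >-> borel_rV R h})
    (Theta : set 'rV[R]_d)
    (G : 'rV[R]_h -> 'rV[R]_d -> 'rV[R]_m)
    (phi : 'rV[R]_m -> R) :
  iid X eta ->
  compact Theta ->
  {within [set: 'rV[R]_h] `*` Theta,
    continuous (fun z : 'rV[R]_h * 'rV[R]_d => G z.1 z.2)} ->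
  (forall alpha : 'rV[R]_m,
    (ereal_sup [set H2 (X 0%N) G theta alpha | theta in Theta] < +oo)%E) ->
  continuous phi ->
  bounded_fun phi ->
  (forall theta, Theta theta -> g eta G phi theta \is a fin_num) /\
  {uniform Theta, gn X G phi @ \oo --> (fun theta => fine (g eta G phi theta))}.
Proof.
move=> XX cTheta cG supH cphi [B0 [_ phiB0]].
have phiB y : `|phi y| <= B0 + 1 by apply: phiB0 => //; rewrite ltrDl.
split=> [t tT|].
  exact: (entropic_inf_fin_num (family_has_exp_moments XX cG supH tT) phiB).
move=> U /uniform_nbhs [E [entE EU]].
have [e /= e0 eE] : exists2 e : R, 0 < e & [set xy | ball xy.1 e xy.2] `<=` E.
  by move: entE; rewrite -entourage_ballE => -[e ? ?]; exists e.
have := (compact_near_coveringP Theta).1 cTheta.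
move/near_covering_withinP.
move=> /(_ nat \oo (fun n t => `|gn X G phi n t - fine (g eta G phi t)| < e) _).
move=> H; have {H} := H (fun t tT => near_gn_same XX cG supH cphi phiB tT e0).
apply: filterS => n Hn; apply: EU => t tT; apply: eE => /=.
by rewrite /ball /= distrC; exact: Hn.
Qed.
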